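(* Let $n\ge 13$ be an integer, let $Q_4(t)=t(t+2)(t+2-n)(t+4-n)$, let $p_c$ be the unique solution $p$ in $\left(\frac{n+4}{n-4},\infty\right)$ of $p\cdot Q_4\left(\frac{4}{p-1}\right)=Q_4\left(\frac{n-4}{2}\right)$, and let $p\ge p_c$. (In other words, suppose that $n>4$, $p>\frac{n+4}{n-4}$ and $p\cdot Q_4\left(\frac{4}{p-1}\right)\le Q_4\left(\frac{n-4}{2}\right)$.) Let $\phi_\alpha,\phi_\beta$ ($\alpha,\beta>0$) be any two positive $\mathcal{C}^4$, radially symmetric solutions of $\Delta^2\phi=\phi^p$ in $\mathbb{R}^n$, with $\phi_\alpha(0)=\alpha$ and $\phi_\beta(0)=\beta$. Then: (a) the graph of $\phi_\alpha$ does not intersect the graph of the singular solution $$\Phi(x)=Q_4(m)^{\frac1{p-1}}\,|x|^{-m},\qquad m=\frac{4}{p-1},\quad x\in\mathbb{R}^n\setminus\{0\};$$ (b) the graph of $\phi_\alpha$ does not intersect the graph of $\phi_\beta$, unless $\alpha=\beta$.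
   Context: Two functions have non-intersecting graphs if they take different values at every point of their common domain; so (a) means $\phi_\alpha(x)\ne\Phi(x)$ for all $x\ne0$, and (b) means that if $\alpha\neq\beta$ then $\phi_\alpha(x)\ne\phi_\beta(x)$ for all $x\in\mathbb{R}^n$. Radially symmetric means symmetric about the origin. The polynomial $Q_4$ satisfies $Q_4(t)=|x|^{t+4}\,\Delta^2|x|^{-t}$. The solutions under consideration are those provided by the following known result: if $n>4$ and $p>\frac{n+4}{n-4}$, the positive $\mathcal{C}^4$, radially symmetric solutions of $\Delta^2\phi=\phi^p$ in $\mathbb{R}^n$ form a one-parameter family $\{\phi_\alpha\}_{\alpha>0}$ with $\phi_\alpha(0)=\alpha$ and $\lim_{|x|\to\infty}|x|^4\phi_\alpha(x)^{p-1}=Q_4\left(\frac{4}{p-1}\right)>0$. For $n\ge13$ the equation defining $p_c$ does have exactly one solution in $\left(\frac{n+4}{n-4},\infty\right)$. *)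

(* Defs.v *)
From HB Require Import structures.
From mathcomp Require Import all_boot all_order all_algebra.
From mathcomp Require Import all_classical all_reals all_analysis.

Set Implicit Arguments.
Unset Strict Implicit.
Unset Printing Implicit Defensive.

Import Order.TTheory GRing.Theory Num.Theory.
Import numFieldNormedType.Exports.

Local Open Scope ring_scope.

(* R^n is 'rV[R]_n. The library norm `|x| on it is the sup norm, so the
   Euclidean norm is introduced separately; both induce the same topology,
   hence the library's continuity and derivatives are the usual ones. *)
Definition enorm (R : realType) (n : nat) (x : 'rV[R]_n) : R :=
  Num.sqrt (\sum_(i < n) x ord0 i ^+ 2).

Definition partial (R : realType) (n : nat) (i : 'I_n) (f : 'rV[R]_n -> R) :
    'rV[R]_n -> R :=
  fun x => 'D_(delta_mx ord0 i) f x.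

(* All iterated partial derivatives of order <= k exist everywhere and are
   continuous. The existence clause is needed because 'D_v f x is total. *)
Fixpoint Ck (R : realType) (n k : nat) (f : 'rV[R]_n -> R) : Prop :=
  continuous f /\
  match k with
  | 0%N => True
  | k'.+1 => forall i : 'I_n,
      (forall x, derivable f x (delta_mx ord0 i)) /\ Ck k' (partial i f)
  end.

Definition laplacian (R : realType) (n : nat) (f : 'rV[R]_n -> R) :
    'rV[R]_n -> R :=
  fun x => \sum_(i < n) partial i (partial i f) x.

Definition bilaplacian (R : realType) (n : nat) (f : 'rV[R]_n -> R) :
    'rV[R]_n -> R :=
  laplacian (laplacian f).

Definition radially_symmetric (R : realType) (n : nat) (f : 'rV[R]_n -> R) :
    Prop :=
  forall x y, enorm x = enorm y -> f x = f y.

Definition positive_radial_solution (R : realType) (n : nat) (p : R)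
    (f : 'rV[R]_n -> R) : Prop :=
  [/\ Ck 4 f,
      forall x, 0 < f x,
      radially_symmetric f &
      forall x, bilaplacian f x = f x `^ p].

Definition Q4 (R : realType) (n : nat) (t : R) : R :=
  t * (t + 2) * (t + 2 - n%:R) * (t + 4 - n%:R).

(* The singular solution; only its values at x != 0 are meaningful. *)
Definition singular_solution (R : realType) (n : nat) (p : R)
    (x : 'rV[R]_n) : R :=
  let m := 4 / (p - 1) in
  Q4 n m `^ (1 / (p - 1)) * enorm x `^ (- m).

(* Main.v *)
(** Write [theta = r d/dr]. For [p >= pc] the operator
    [r^4 Delta^2 - p Q4(m)], the linearization at [Phi], factors on radial
    functions as a product of four real first-order operators [theta + t_i]
    with [t1, t2, t3 > m] and [t4 < -2]. By convexity of [s^p], the difference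
    [D = Phi - phi_alpha] is sent by this operator to a nonpositive function.
    Solutions are radially nonincreasing (a positive value of the Laplacian
    would force blow-up at a finite radius), so [D] cannot tend to [-oo] like
    [- r^(-t4)]; together with [D = O(r^(-m))] at 0 this lets one undo the
    four factors one after the other, whence [D >= 0] and [r^t1 D] is
    nondecreasing. If [D] vanished at a point it would vanish on all smaller
    radii, which is impossible since [Phi] is unbounded at 0. The same
    argument applied to [M + phi_alpha - phi_beta], where [alpha > beta] and
    [M >= 0] is the maximum of [phi_beta - phi_alpha], separates two regular
    solutions. *)

Require Import Defs.
From mathcomp Require Import all_boot all_order all_algebra.
From mathcomp Require Import all_classical all_reals all_analysis.
From mathcomp Require Import ring lra.

Set Implicit Arguments.
Unset Strict Implicit.
Unset Printing Implicit Defensive.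

Import Order.TTheory GRing.Theory Num.Theory.
Import numFieldNormedType.Exports.

Local Open Scope ring_scope.

(** * One-variable calculus *)

Section Calculus.
Context {R : realType}.
Implicit Types (f g : R -> R) (a b x y r s t k : R).

Lemma eq_ler x y : x = y -> x <= y.
Proof. by move->. Qed.

Lemma powR_gt0D x s t : 0 < x -> x `^ (s + t) = x `^ s * x `^ t.
Proof. by move=> x0; rewrite powRD // (lt0r_neq0 x0) implybT. Qed.

Lemma powR_gt0B1 x t : 0 < x -> x `^ t = x * x `^ (t - 1).
Proof.
by move=> x0; rewrite -{2}(powRr1 (ltW x0)) -powR_gt0D //; congr powR; ring.
Qed.

Lemma is_deriveDf f g x a b : is_derive x 1 f a -> is_derive x 1 g b ->
  is_derive x 1 (fun y => f y + g y) (a + b).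
Proof. exact: is_deriveD. Qed.

Lemma is_deriveBf f g x a b : is_derive x 1 f a -> is_derive x 1 g b ->
  is_derive x 1 (fun y => f y - g y) (a - b).
Proof. exact: is_deriveB. Qed.

Lemma is_deriveMf f g x a b : is_derive x 1 f a -> is_derive x 1 g b ->
  is_derive x 1 (fun y => f y * g y) (a * g x + f x * b).
Proof.
move=> fa gb; apply: (is_derive_eq (is_deriveM fa gb)).
by rewrite /GRing.scale /= addrC mulrC.
Qed.

Lemma is_derive_cstf a x : is_derive x 1 (fun=> a) 0.
Proof. exact: is_derive_cst. Qed.

Lemma is_derive_idf x : is_derive x 1 (fun y : R => y) 1.
Proof. exact: is_derive_id. Qed.

Lemma is_deriveZf a f x b : is_derive x 1 f b ->
  is_derive x 1 (fun y => a * f y) (a * b).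
Proof.
move=> fb; have := is_deriveMf (is_derive_cstf a x) fb.
by rewrite mul0r add0r.
Qed.

Lemma is_deriveVf f x a : f x != 0 -> is_derive x 1 f a ->
  is_derive x 1 (fun y => (f y)^-1) (- (f x) ^- 2 * a).
Proof. exact: is_deriveV. Qed.

Lemma is_derive_compf f g x a b : is_derive x 1 g b ->
  is_derive (g x) 1 f a -> is_derive x 1 (fun y => f (g y)) (a * b).
Proof.
move=> gb fa; apply: (is_derive_eq (is_derive1_comp fa gb)).
by [].
Qed.

Lemma is_deriveXf n x : is_derive x 1 (fun y : R => y ^+ n) (n%:R * x ^+ n.-1).
Proof.
have := is_deriveX n (is_derive_id x (1 : R)).
rewrite /GRing.scale /= mulr1 -mulr_natl => h.
by rewrite [X in is_derive _ _ X _](_ : _ = (id : R -> R) ^+ n) // exprfctE.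
Qed.

Lemma is_derive_powRf a x : 0 < x ->
  is_derive x 1 (fun y => y `^ a) (a * x `^ (a - 1)).
Proof. by move=> x0; apply: is_derive1_powR. Qed.

Lemma is_derive_continuous f x a : is_derive x 1 f a -> {for x, continuous f}.
Proof.
move=> [fd _]; apply: differentiable_continuous; exact/derivable1_diffP.
Qed.

Lemma le_of_derive_ge0 f df a b : a <= b ->
  (forall x, a <= x <= b -> is_derive x 1 f (df x)) ->
  (forall x, a <= x <= b -> 0 <= df x) -> f a <= f b.
Proof.
move=> ab fd df0.
have [x|c|c /[!in_itv]/= cab fab] := MVT_segment ab (f := f) (df := df).
- by rewrite in_itv /= => /andP[/ltW ax /ltW xb]; apply: fd; rewrite ax.
- apply: continuous_in_subspaceT => x /[!inE]/= /[!in_itv]/= xab.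
  exact: is_derive_continuous (fd _ xab).
by rewrite -subr_ge0 fab mulr_ge0 ?subr_ge0 ?df0.
Qed.

End Calculus.

(** * First-order Euler operators [r d/dr + t] on the half-line *)

Section Euler.
Context {R : realType}.
Implicit Types (D : nat -> R -> R) (f : R -> R) (c r s t k : R) (N : nat).

Definition jet N D :=
  forall j r, (j < N)%N -> 0 < r -> is_derive r 1 (D j) (D j.+1 r).

(* The jet of [r D' + t D], where [D j] is the [j]-th derivative of [D 0]. *)
Definition euler t D : nat -> R -> R :=
  fun j r => (t + j%:R) * D j r + r * D j.+1 r.

(** The weight [r^j] makes the bound scale invariant, so an Euler operator keeps the exponent [k]
    and costs only one order. *)
Definition near0 k N D := forall j, (j <= N)%N ->
  exists C, forall r, 0 < r <= 1 -> `|D j r| * r ^+ j <= C * r `^ (- k).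

Definition eventually_below s f := exists c r0,
  [/\ 0 < c, 0 < r0 & forall r, r0 <= r -> f r <= - (c * r `^ s)].

Lemma jetW M N D : (M <= N)%N -> jet N D -> jet M D.
Proof. by move=> MN jD j r jM; apply: jD; apply: leq_trans jM MN. Qed.

Lemma jet_euler N t D : jet N.+1 D -> jet N (euler t D).
Proof.
move=> jD j r jN r0.
have h := is_deriveDf (is_deriveZf (t + j%:R) (jD j r (leqW jN) r0))
  (is_deriveMf (is_derive_idf r) (jD j.+1 r jN r0)).
apply: (is_derive_eq h).
by rewrite /euler -[j.+1]addn1 natrD; ring.
Qed.

Lemma near0_euler N k t D : near0 k N.+1 D -> near0 k N (euler t D).
Proof.
move=> nD j jN.
have [C HC] := nD j (leqW jN); have [C' HC'] := nD j.+1 jN.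
exists (`|t + j%:R| * C + C') => r r01.
have r0 : 0 < r by case/andP: r01.
have h1 := HC r r01; have h2 := HC' r r01.
have : `|euler t D j r| <= `|t + j%:R| * `|D j r| + r * `|D j.+1 r|.
  by rewrite /euler (le_trans (ler_normD _ _)) // !normrM (gtr0_norm r0).
move=> /(ler_wpM2r (exprn_ge0 j (ltW r0))) /le_trans; apply.
rewrite !mulrDl; apply: lerD.
  by rewrite -!mulrA ler_wpM2l.
by apply: le_trans h2; rewrite exprS; apply: eq_ler; ring.
Qed.

(** [r^t] is the integrating factor of [r d/dr + t]; the sign of an Euler image thus becomes
    monotonicity of [r^t D]. *)
Lemma is_derive_powR_jet t D r : jet 1 D -> 0 < r ->
  is_derive r 1 (fun y => y `^ t * D 0%N y) (r `^ (t - 1) * euler t D 0%N r).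
Proof.
move=> jD r0.
apply: (is_derive_eq (is_deriveMf (is_derive_powRf t r0) (jD 0%N r isT r0))).
by rewrite (powR_gt0B1 t r0) /euler; ring.
Qed.

Lemma powR_eventually_le a e : 0 < a -> 0 < e ->
  exists2 d : R, 0 < d & forall r, 0 < r <= d -> r `^ a <= e.
Proof.
move=> a0 e0; exists (e `^ (a^-1)); first exact: powR_gt0.
move=> r /andP[r0 re].
have -> : e = (e `^ a^-1) `^ a by rewrite -powRrM mulVf ?gt_eqF// powRr1 ?ltW.
by apply: ge0_ler_powR; rewrite ?nnegrE ?powR_ge0 ?(ltW r0) ?(ltW a0).
Qed.

Lemma powR_eventually_ge a e : 0 < a -> 0 < e ->
  exists2 d : R, 0 < d & forall r, d <= r -> e <= r `^ a.
Proof.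
move=> a0 e0; exists (e `^ (a^-1)); first exact: powR_gt0.
move=> r re.
have {1}-> : e = (e `^ a^-1) `^ a by rewrite -powRrM mulVf ?gt_eqF// powRr1 ?ltW.
by apply: ge0_ler_powR; rewrite ?nnegrE ?powR_ge0 ?(ltW a0) ?(le_trans (powR_ge0 _ _) re).
Qed.

Lemma euler_ge0_ndecr t D : jet 1 D -> (forall r, 0 < r -> 0 <= euler t D 0%N r) ->
  forall r1 r2, 0 < r1 -> r1 <= r2 -> r1 `^ t * D 0%N r1 <= r2 `^ t * D 0%N r2.
Proof.
move=> jD ED r1 r2 r10 r12.
apply: (le_of_derive_ge0 (f := fun y => y `^ t * D 0%N y) r12
  (df := fun r => r `^ (t - 1) * euler t D 0%N r)).
  by move=> x /andP[rx _]; apply: is_derive_powR_jet => //; apply: lt_le_trans rx.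
move=> x /andP[rx _]; rewrite mulr_ge0 ?powR_ge0 // ED //.
exact: lt_le_trans rx.
Qed.

(** [r^t D] is nondecreasing and [O(r^(t - k))], hence tends to 0 at the origin; it can never be
    negative. *)
Lemma ge0_of_euler_ge0 k t D : jet 1 D -> near0 k 0 D -> k < t ->
  (forall r, 0 < r -> 0 <= euler t D 0%N r) -> forall r, 0 < r -> 0 <= D 0%N r.
Proof.
move=> jD nD kt ED r0 r00; rewrite leNgt; apply/negP => Dr0.
have [C HC] := nD 0%N isT.
pose e := - (r0 `^ t * D 0%N r0).
have e0 : 0 < e by rewrite /e oppr_gt0 pmulr_rlt0 // powR_gt0.
have tk0 : 0 < t - k by rewrite subr_gt0.
have eC0 : 0 < e / (2 * (`|C| + 1)).
  by rewrite divr_gt0 // mulr_gt0 // ltr_wpDl.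
have [d d0 Hd] := powR_eventually_le tk0 eC0.
pose r := Num.min d (Num.min 1 r0).
have r_gt0 : 0 < r by rewrite /r !lt_min d0 ltr01 r00.
have rd : r <= d by rewrite /r ge_min lexx.
have r1 : r <= 1 by rewrite /r !ge_min lexx orbT.
have rr0 : r <= r0 by rewrite /r !ge_min lexx !orbT.
have mono := euler_ge0_ndecr jD ED r_gt0 rr0.
have := HC r; rewrite r_gt0 r1 expr0 mulr1 => /(_ isT) hC.
have := Hd r; rewrite r_gt0 rd => /(_ isT) hd.
have rt0 := powR_gt0 t r_gt0.
have h1 : `|D 0%N r| * r `^ t <= (`|C| + 1) * r `^ (t - k).
  have -> : r `^ (t - k) = r `^ (- k) * r `^ t.
    by rewrite -powR_gt0D //; congr powR; ring.
  rewrite mulrA ler_pM2r // (le_trans hC) // ler_wpM2r ?powR_ge0 //.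
  by rewrite ler_wpDr ?ler_norm.
have h2 : (`|C| + 1) * r `^ (t - k) <= e / 2.
  have C0 : 0 < `|C| + 1 by rewrite ltr_wpDl.
  rewrite (le_trans (ler_wpM2l (ltW C0) hd)) //; apply: eq_ler; field.
  by rewrite gt_eqF.
have h3 : - (r `^ t * D 0%N r) <= `|D 0%N r| * r `^ t.
  by rewrite mulrC -mulNr ler_pM2r // -normrN ler_norm.
have he : r0 `^ t * D 0%N r0 = - e by rewrite /e opprK.
by rewrite he in mono; lra.
Qed.

(** Integrating [(r^t D)' <= - c r^(t + s - 1)] bounds [r^t D] by [- c / (t + s) * r^(t + s)] up to
    a constant, and [t + s > 0] makes the power dominate. *)
Lemma eventually_below_of_euler s t D : 0 < t + s -> jet 1 D ->
  eventually_below s (euler t D 0%N) -> eventually_below s (D 0%N).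
Proof.
move=> ts jD [c [r0 [c0 r00 Hc]]].
pose g r := c / (t + s) * r `^ (t + s) + r `^ t * D 0%N r.
have gdec r : r0 <= r -> g r <= g r0.
  move=> r0r; rewrite -lerN2.
  apply: (le_of_derive_ge0 (f := fun y => - g y) r0r
    (df := fun r => - (r `^ (t - 1) * (c * r `^ s + euler t D 0%N r)))).
    move=> x /andP[rx _]; have x0 : 0 < x by apply: lt_le_trans rx.
    have h := is_deriveZf (-1) (is_deriveDf
      (is_deriveZf (c / (t + s)) (is_derive_powRf (t + s) x0)) (is_derive_powR_jet t jD x0)).
    have -> : (fun y => - g y) = (fun y => -1 * (c / (t + s) * y `^ (t + s) + y `^ t * D 0%N y)).
      by apply/funext => y; rewrite mulN1r.
    apply: (is_derive_eq h).
    have -> : x `^ (t + s - 1) = x `^ (t - 1) * x `^ s.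
      by rewrite -powR_gt0D //; congr powR; ring.
    by field; rewrite gt_eqF.
  move=> x /andP[rx _]; rewrite oppr_ge0 mulr_ge0_le0 ?powR_ge0 //.
  by have := Hc x rx; lra.
(* Half of the coefficient [c / (t + s)] is kept; the other half absorbs the constant [g r0] for
   large [r]. *)
have e0 : 0 < c / (2 * (t + s)) by rewrite divr_gt0 // mulr_gt0.
have eB : 0 < (`|g r0| + 1) / (c / (2 * (t + s))) by rewrite divr_gt0 // ltr_wpDl.
have [d d0 Hd] := powR_eventually_ge ts eB.
exists (c / (2 * (t + s))), (Num.max r0 d); split => //.
  by rewrite lt_max r00.
move=> r; rewrite ge_max => /andP[r0r dr].
have r_gt0 : 0 < r by apply: lt_le_trans r0r.
have := Hd r dr; rewrite ler_pdivrMr // => hd.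
have hg := gdec r r0r; have gn := ler_norm (g r0).
have rt0 := powR_gt0 t r_gt0.
rewrite -(ler_pM2l rt0).
have hts : r `^ (t + s) = r `^ t * r `^ s by apply: powR_gt0D.
have e2 : c / (t + s) = c / (2 * (t + s)) * 2 by field; rewrite gt_eqF.
move: hg; rewrite {1}/g e2 mulrN mulrCA -hts => hg.
set P := r `^ (t + s) in hd hg *; set e := c / (2 * (t + s)) in hd hg *.
have : e * 2 * P = P * e * 2 by ring.
have : e * P = P * e by ring.
move=> -> E2; rewrite E2 in hg; move: hg hd gn; lra.
Qed.

(** [r^t D] is nonincreasing, so beyond [r0] it stays at or below its negative value there. *)
Lemma eventually_below_of_euler_le0 t D r0 : jet 1 D ->
  (forall r, 0 < r -> euler t D 0%N r <= 0) -> 0 < r0 -> D 0%N r0 < 0 ->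
  eventually_below (- t) (D 0%N).
Proof.
move=> jD ED r00 Dr0.
exists (- (r0 `^ t * D 0%N r0)), r0; split => //.
  by rewrite oppr_gt0 pmulr_rlt0 // powR_gt0.
move=> r r0r; have r_gt0 : 0 < r by apply: lt_le_trans r0r.
have h : r `^ t * D 0%N r <= r0 `^ t * D 0%N r0.
  rewrite -lerN2.
  apply: (le_of_derive_ge0 (f := fun y => - (y `^ t * D 0%N y)) r0r
    (df := fun r => -1 * (r `^ (t - 1) * euler t D 0%N r))).
    move=> x /andP[rx _]; have x0 : 0 < x by apply: lt_le_trans rx.
    have -> : (fun y => - (y `^ t * D 0%N y)) = (fun y => -1 * (y `^ t * D 0%N y)).
      by apply/funext => y; rewrite mulN1r.
    exact: is_deriveZf (is_derive_powR_jet t jD x0).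
  move=> x /andP[rx _]; rewrite mulN1r oppr_ge0 mulr_ge0_le0 ?powR_ge0 // ED //.
  exact: lt_le_trans rx.
rewrite powRN mulNr opprK -ler_pdivrMr ?invr_gt0 ?powR_gt0 // invrK.
by rewrite mulrC.
Qed.

(* The outermost operator has the growing homogeneous solution [r ^ (- t4)]:
   a negative value of its argument would propagate to infinity. The inner
   three have homogeneous solutions more singular at 0 than [D]. *)
Lemma euler4_comparison k t1 t2 t3 t4 D :
  0 <= k -> k < t1 -> k < t2 -> k < t3 -> t4 < 0 -> jet 4 D -> near0 k 3 D ->
  (forall r, 0 < r ->
    euler t4 (euler t3 (euler t2 (euler t1 D))) 0%N r <= 0) ->
  ~ eventually_below (- t4) (D 0%N) ->
  (forall r, 0 < r -> 0 <= D 0%N r) /\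
  (forall r1 r2, 0 < r1 -> r1 <= r2 ->
    r1 `^ t1 * D 0%N r1 <= r2 `^ t1 * D 0%N r2).
Proof.
move=> k0 kt1 kt2 kt3 t40 jD nD ED ninf.
set D1 := euler t1 D in ED *; set D2 := euler t2 D1 in ED; set D3 := euler t3 D2 in ED.
have j1 : jet 3 D1 by apply: jet_euler.
have j2 : jet 2 D2 by apply: jet_euler.
have j3 : jet 1 D3 by apply: jet_euler.
have n1 : near0 k 2 D1 by apply: near0_euler.
have n2 : near0 k 1 D2 by apply: near0_euler.
have D30 r : 0 < r -> 0 <= D3 0%N r.
  move=> r0; rewrite leNgt; apply/negP => neg; apply: ninf.
  have ts t : k < t -> 0 < t + - t4 by move: k0 t40; lra.
  have := eventually_below_of_euler_le0 j3 ED r0 neg.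
  move/(eventually_below_of_euler (ts _ kt3) (jetW (isT : (1 <= 2)%N) j2)).
  move/(eventually_below_of_euler (ts _ kt2) (jetW (isT : (1 <= 3)%N) j1)).
  by move/(eventually_below_of_euler (ts _ kt1) (jetW (isT : (1 <= 4)%N) jD)).
have D20 := ge0_of_euler_ge0 (jetW (isT : (1 <= 2)%N) j2)
  (fun j h => n2 j (leq_trans h (isT : (0 <= 1)%N))) kt3 D30.
have D10 := ge0_of_euler_ge0 (jetW (isT : (1 <= 3)%N) j1)
  (fun j h => n1 j (leq_trans h (isT : (0 <= 2)%N))) kt2 D20.
split; last exact: euler_ge0_ndecr (jetW (isT : (1 <= 4)%N) jD) D10.
exact: (ge0_of_euler_ge0 (jetW (isT : (1 <= 4)%N) jD)
  (fun j h => nD j (leq_trans h (isT : (0 <= 3)%N))) kt1 D10).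
Qed.

End Euler.

(** * The polynomial [Q4], the critical exponent and the roots of the linearized operator *)

Section Exponents.
Context {R : realType}.
Implicit Types (p m c l : R) (n : nat).

(* [p * Q4 m] in terms of [m], since [p * m = m + 4]; centred at [(n - 6) / 2]
   it is even in [z]. *)
Lemma mul_Q4E n p : p - 1 != 0 ->
  let z := 4 / (p - 1) - (n%:R - 6) / 2 in
  p * Q4 n (4 / (p - 1)) =
  (((n%:R - 2) / 2) ^+ 2 - z ^+ 2) * (((n%:R + 2) / 2) ^+ 2 - z ^+ 2).
Proof. by move=> p1; rewrite /Q4 /=; field. Qed.

Lemma exponent_bounds n p : (13 <= n)%N -> (n%:R + 4) / (n%:R - 4) < p ->
  [/\ 1 < p, 0 < 4 / (p - 1) & 4 / (p - 1) < (n%:R - 4) / 2].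
Proof.
move=> hn hp.
have hN : 13 <= n%:R :> R by rewrite (ler_nat R 13 n).
have N4 : 0 < n%:R - 4 :> R by lra.
rewrite ltr_pdivrMr // in hp.
have p1 : 0 < p - 1 by nra.
split; [lra | exact: divr_gt0 |].
by rewrite ltr_pdivrMr //; nra.
Qed.

(** The right-hand side is the Hardy-Rellich constant. As [p] grows, [m] and hence the centred
    variable [z] of [mul_Q4E] decrease; since [z < - 1] already at [pc], [z^2] increases and both
    factors shrink. *)
Lemma Q4_supercritical n pc p : (13 <= n)%N ->
  (n%:R + 4) / (n%:R - 4) < pc ->
  pc * Q4 n (4 / (pc - 1)) = Q4 n ((n%:R - 4) / 2) -> pc <= p ->
  p * Q4 n (4 / (p - 1)) <= Q4 n ((n%:R - 4) / 2).
Proof.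
move=> hn hpc hpcE hp.
have [pc1 mc0 mcN] := exponent_bounds hn hpc.
have [p1 m0 mN] := exponent_bounds hn (lt_le_trans hpc hp).
have mle : 4 / (p - 1) <= 4 / (pc - 1).
  by rewrite ler_pM2l // lef_pV2 ?posrE ?subr_gt0 // lerB.
rewrite -hpcE; move: hpcE.
rewrite !mul_Q4E ?gt_eqF ?subr_gt0 //=.
have hN : 13 <= n%:R :> R by rewrite (ler_nat R 13 n).
move: mle m0 mN mc0 mcN; set m := 4 / (p - 1); set mc := 4 / (pc - 1).
move=> mle m0 mN mc0 mcN.
rewrite /Q4; set z := mc - _; set y := m - _ => hE.
set c := (n%:R - 4) / 2 : R.
have cE : n%:R = 2 * c + 4 :> R by rewrite /c; field.
have zc : z = mc - c + 1 by rewrite /z cE; field.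
have yc : y = m - c + 1 by rewrite /y cE; field.
have c4 : 4 < c by lra.
(* The product [((c + 1)^2 - 1) ((c + 3)^2 - 1)] is the value at [z^2 = 1]; it exceeds
   [Q4 c = c^2 (c + 2)^2] by [4 c (c + 2)^2]. *)
have {}hE : ((c + 1) ^+ 2 - z ^+ 2) * ((c + 3) ^+ 2 - z ^+ 2) =
    ((c + 1) ^+ 2 - 1) * ((c + 3) ^+ 2 - 1) - 4 * (c * (c + 2) ^+ 2).
  move: hE; rewrite -/c cE => E.
  by transitivity (c * (c + 2) * (c + 2 - (2 * c + 4)) * (c + 4 - (2 * c + 4)));
    [rewrite -E; field | ring].
have z1 : z < 1 by rewrite zc; lra.
have zlb : 1 - c < z by rewrite zc; lra.
have ylb : 1 - c < y by rewrite yc; lra.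
have yz : y <= z by rewrite yc zc; lra.
(* If [z^2 <= 1], both factors are at least their values at [z^2 = 1], which makes the product too
   large. With [z < 1], what remains is [z < - 1]. *)
have z2 : 1 < z ^+ 2.
  rewrite ltNge; apply/negP => zle.
  have c0 : 0 < c * (c + 2) ^+ 2 by rewrite mulr_gt0 ?exprn_gt0; lra.
  have : ((c + 1) ^+ 2 - 1) * ((c + 3) ^+ 2 - 1) <=
         ((c + 1) ^+ 2 - z ^+ 2) * ((c + 3) ^+ 2 - z ^+ 2).
    by apply: ler_pM; [nra | nra | lra | lra].
  by rewrite hE; lra.
have zm1 : z < - 1 by nra.
have y2 : z ^+ 2 <= y ^+ 2 by nra.
have yc2 : y ^+ 2 <= c ^+ 2 by nra.
rewrite cE (_ : (2 * c + 4 - 2) / 2 = c + 1); last by field.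
rewrite (_ : (2 * c + 4 + 2) / 2 = c + 3); last by field.
by apply: ler_pM; [nra | nra | lra | lra].
Qed.

Lemma Q4_gt0 n m : (13 <= n)%N -> 0 < m -> m < (n%:R - 4) / 2 -> 0 < Q4 n m.
Proof.
move=> hn m0 mN; have hN : 13 <= n%:R :> R by rewrite (ler_nat R 13 n).
rewrite (_ : Q4 n m = m * (m + 2) * ((n%:R - 2 - m) * (n%:R - 4 - m))); last first.
  by rewrite /Q4; ring.
by apply: mulr_gt0; apply: mulr_gt0; lra.
Qed.

(* With [w = (t - c)^2] and [c = (n - 4) / 2], [Q4 t = (w - c^2) (w - (c + 2)^2)]. *)
Lemma Q4_shift_roots n m l : (13 <= n)%N -> 0 < m -> m < (n%:R - 4) / 2 ->
  Q4 n m < l -> l <= Q4 n ((n%:R - 4) / 2) ->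
  exists t1 t2 t3 t4 : R, [/\ m < t1, m < t2, m < t3, t4 < - 2 &
    forall D r, euler t4 (euler t3 (euler t2 (euler t1 D))) 0%N r =
      euler 0 (euler (- 2) (euler (n%:R - 2) (euler (n%:R - 4) D))) 0%N r
      - l * D 0%N r].
Proof.
move=> hn m0 mN Qm Ql.
have hN : 13 <= n%:R :> R by rewrite (ler_nat R 13 n).
have Qm0 := Q4_gt0 hn m0 mN.
set c := (n%:R - 4) / 2 : R in mN Ql.
have cE : n%:R = 2 * c + 4 :> R by rewrite /c; field.
have c4 : 4 < c by lra.
have QE t : Q4 n t = ((t - c) ^+ 2 - c ^+ 2) * ((t - c) ^+ 2 - (c + 2) ^+ 2).
  by rewrite /Q4 cE; ring.
have l0 : 0 < l by apply: lt_trans Qm.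
have lc : l <= c ^+ 2 * (c + 2) ^+ 2 by move: Ql; rewrite QE; nra.
(* In [w] the equation [Q4 t = l] is quadratic with root sum [S] and root difference [d]; its roots
   are [a^2] and [b^2]. The bound [l <= c^2 (c + 2)^2] gives [d <= S], so [b] is real. *)
pose S := c ^+ 2 + (c + 2) ^+ 2.
pose d := Num.sqrt (((c + 2) ^+ 2 - c ^+ 2) ^+ 2 + 4 * l).
have d2 : d ^+ 2 = ((c + 2) ^+ 2 - c ^+ 2) ^+ 2 + 4 * l.
  by rewrite sqr_sqrtr // addr_ge0 ?sqr_ge0 // mulr_ge0 // ltW.
have d0 : 0 <= d by apply: sqrtr_ge0.
have dgt : (c + 2) ^+ 2 - c ^+ 2 < d by nra.
have dS : d <= S by rewrite /S; nra.
pose a := Num.sqrt ((S + d) / 2); pose b := Num.sqrt ((S - d) / 2).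
have a2 : a ^+ 2 = (S + d) / 2 by rewrite sqr_sqrtr // /S; nra.
have b2 : b ^+ 2 = (S - d) / 2 by rewrite sqr_sqrtr //; lra.
have a0 : 0 <= a by apply: sqrtr_ge0.
have b0 : 0 <= b by apply: sqrtr_ge0.
have agt : c + 2 < a by rewrite /S in a2; nra.
(* [Q4 n m < l] puts [(m - c)^2] strictly between [b^2] and [a^2]. *)
have bm : b < c - m.
  have : ((m - c) ^+ 2 - a ^+ 2) * ((m - c) ^+ 2 - b ^+ 2) < 0.
    have -> : ((m - c) ^+ 2 - a ^+ 2) * ((m - c) ^+ 2 - b ^+ 2) = Q4 n m - l.
      rewrite QE a2 b2.
      transitivity ((m - c) ^+ 4 - S * (m - c) ^+ 2 + (S ^+ 2 - d ^+ 2) / 4).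
        by field.
      by rewrite d2 /S; field.
    by lra.
  rewrite nmulr_rlt0; first by rewrite subr_gt0; nra.
  by nra.
exists (c + a), (c + b), (c - b), (c - a); split; [lra | lra | lra | lra |].
move=> D r.
have lE : l = c ^+ 2 * (c + 2) ^+ 2 - a ^+ 2 * b ^+ 2.
  rewrite a2 b2.
  transitivity (c ^+ 2 * (c + 2) ^+ 2 - (S ^+ 2 - d ^+ 2) / 4); last by field.
  by rewrite d2 /S; field.
have aE : a ^+ 2 = c ^+ 2 + (c + 2) ^+ 2 - b ^+ 2 by rewrite a2 b2 /S; field.
(* An identity valid for all [a], [b]: the last coefficient is the defect in the sum of the roots,
   and vanishes by [aE]. *)
have h : euler (c - a) (euler (c - b) (euler (c + b) (euler (c + a) D))) 0%N r =
    euler 0 (euler (- 2) (euler (n%:R - 2) (euler (n%:R - 4) D))) 0%N r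
    - (c ^+ 2 * (c + 2) ^+ 2 - a ^+ 2 * b ^+ 2) * D 0%N r
    + (c ^+ 2 + (c + 2) ^+ 2 - b ^+ 2 - a ^+ 2) * euler c (euler c D) 0%N r.
  by rewrite /euler cE; ring.
by rewrite h -lE -aE subrr mul0r addr0.
Qed.

(** Convexity of [s^p] at [x], obtained from Young's inequality for [y] and [x^(p - 1)] with
    exponents [p] and [p / (p - 1)]. *)
Lemma powR_tangent p (x y : R) : 1 < p -> 0 < x -> 0 <= y ->
  p * x `^ (p - 1) * (y - x) <= y `^ p - x `^ p.
Proof.
move=> p1 x0 y0.
have p0 : 0 < p by apply: lt_trans p1.
have pm1 : 0 < p - 1 by rewrite subr_gt0.
have q0 : 0 < p / (p - 1) by rewrite divr_gt0.
have pq : p^-1 + (p / (p - 1))^-1 = 1 by field; rewrite !gt_eqF.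
have := conjugate_powR y0 (powR_ge0 x (p - 1)) p0 q0 pq.
rewrite -powRrM (_ : (p - 1) * (p / (p - 1)) = p); last by field; rewrite gt_eqF.
rewrite -(ler_pM2l p0) => h.
have xE := powR_gt0B1 p x0.
have e : p * (y `^ p / p + x `^ p / (p / (p - 1))) = y `^ p + (p - 1) * x `^ p.
  by field; rewrite !gt_eqF.
rewrite e xE in h; rewrite xE; move: h.
set X := x `^ (p - 1); set Y := y `^ p => h.
have -> : p * X * (y - x) = p * (y * X) - p * (x * X) by ring.
have : (p - 1) * (x * X) = p * (x * X) - x * X by ring.
by move=> E; rewrite E in h; lra.
Qed.

End Exponents.

(** * Radial functions on [R^n] and the bilaplacian in the radial variable *)

Section Radial.
Context {R : realType}.
Implicit Types (f g : R -> R) (a b c r s t : R) (n : nat).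

Lemma is_derive_lineP n (phi : 'rV[R]_n -> R) (x v : 'rV[R]_n) c :
  is_derive x v phi c <-> is_derive (0 : R) 1 (fun h => phi (h *: v + x)) c.
Proof.
have gE : (fun h : R => h^-1 *: (phi ((h *: 1 + 0) *: v + x) - phi (0 *: v + x))) =
          (fun h : R => h^-1 *: (phi (h *: v + x) - phi x)).
  apply/funext => h; rewrite scale0r add0r addr0.
  by rewrite /GRing.scale /= mulr1.
by split=> -[dphi Dphi]; split; move: dphi Dphi; rewrite /derivable /derive /= gE.
Qed.

Lemma enorm_ge0 n (x : 'rV[R]_n) : 0 <= enorm x.
Proof. exact: sqrtr_ge0. Qed.

Lemma sqr_enorm n (x : 'rV[R]_n) : enorm x ^+ 2 = \sum_(i < n) x ord0 i ^+ 2.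
Proof. by rewrite sqr_sqrtr // sumr_ge0 // => i _; apply: sqr_ge0. Qed.

Lemma enorm_gt0 n (x : 'rV[R]_n) : x != 0 -> 0 < enorm x.
Proof.
move=> x0; rewrite lt_neqAle enorm_ge0 andbT eq_sym; apply: contra x0 => /eqP e0.
have /eqP := sqr_enorm x; rewrite e0 expr0n /= eq_sym psumr_eq0; last first.
  by move=> i _; apply: sqr_ge0.
move=> /allP xi; apply/eqP/rowP => i; rewrite mxE.
by have := xi i; rewrite mem_index_enum sqrf_eq0 => /(_ isT)/eqP.
Qed.

Lemma enorm0 n : enorm (0 : 'rV[R]_n) = 0.
Proof.
apply/eqP; rewrite -sqrf_eq0 sqr_enorm big1 // => i _.
by rewrite mxE expr0n.
Qed.

Lemma sqr_enorm_line n (x : 'rV[R]_n) (i : 'I_n) h :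
  enorm (h *: delta_mx ord0 i + x) ^+ 2 = h ^+ 2 + 2 * x ord0 i * h + enorm x ^+ 2.
Proof.
rewrite !sqr_enorm (bigD1 i) //= [in RHS](bigD1 i) //= !mxE !eqxx /=.
under eq_bigr => j ji do rewrite !mxE eqxx (negbTE ji) /= mulr0 add0r.
by ring.
Qed.

Lemma is_derive_enorm n (x : 'rV[R]_n) (i : 'I_n) : x != 0 ->
  is_derive x (delta_mx ord0 i) (@enorm R n) (x ord0 i / enorm x).
Proof.
move=> x0; apply/is_derive_lineP.
have ex0 := enorm_gt0 x0.
pose q h := h * h + 2 * x ord0 i * h + enorm x ^+ 2.
have -> : (fun h => enorm (h *: delta_mx ord0 i + x)) = (fun h => Num.sqrt (q h)).
  apply/funext => h.
  by rewrite -[LHS]ger0_norm ?enorm_ge0 // -sqrtr_sqr sqr_enorm_line /q expr2.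
have hq : is_derive (0 : R) 1 q (2 * x ord0 i).
  have h := is_deriveDf (is_deriveDf (is_deriveMf (is_derive_idf 0) (is_derive_idf (0 : R)))
    (is_deriveZf (2 * x ord0 i) (is_derive_idf 0))) (is_derive_cstf (enorm x ^+ 2) (0 : R)).
  by apply: (is_derive_eq h); ring.
have q0 : q 0 = enorm x ^+ 2 by rewrite /q; ring.
have hs : is_derive (q 0) 1 Num.sqrt (2 * Num.sqrt (q 0))^-1.
  by apply: is_derive1_sqrt; rewrite q0 exprn_gt0.
apply: (is_derive_eq (is_derive_compf hq hs)).
by rewrite q0 sqrtr_sqr gtr0_norm //; field; rewrite gt_eqF.
Qed.

Lemma is_derive_coord n (x : 'rV[R]_n) (i j : 'I_n) :
  is_derive x (delta_mx ord0 i) (fun y : 'rV[R]_n => y ord0 j) (i == j)%:R.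
Proof.
apply/is_derive_lineP.
have -> : (fun h => (h *: delta_mx ord0 i + x) ord0 j) = (fun h => (i == j)%:R * h + x ord0 j).
  by apply/funext => h; rewrite !mxE eqxx eq_sym mulrC.
have h := is_deriveDf (is_deriveZf (i == j)%:R (is_derive_idf (0 : R))) (is_derive_cstf (x ord0 j) 0).
by apply: (is_derive_eq h); rewrite mulr1 addr0.
Qed.

Lemma is_derive_radial n f a (x : 'rV[R]_n) (i : 'I_n) : x != 0 ->
  is_derive (enorm x) 1 f a ->
  is_derive x (delta_mx ord0 i) (fun y => f (enorm y)) (a * (x ord0 i / enorm x)).
Proof.
move=> x0 fa; apply/is_derive_lineP.
apply: (is_derive_compf (f := f) (g := fun h => enorm (h *: delta_mx ord0 i + x))).
  exact: (iffLR (is_derive_lineP _ _ _ _) (is_derive_enorm i x0)).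
by rewrite scale0r add0r.
Qed.

Lemma near_neq0 n (x : 'rV[R]_n) : x != 0 -> \forall y \near x, y != 0.
Proof.
by move=> x0; have h := @cvgr_neq0 _ _ _ (nbhs x) _ id x; apply: h => //; apply: cvg_id.
Qed.

Lemma partial_radial n (phi : 'rV[R]_n -> R) f f1 (i : 'I_n) :
  (forall y, y != 0 -> phi y = f (enorm y)) ->
  (forall r, 0 < r -> is_derive r 1 f (f1 r)) ->
  forall x, x != 0 -> partial i phi x = f1 (enorm x) / enorm x * x ord0 i.
Proof.
move=> phif ff1 x x0.
have h : is_derive x (delta_mx ord0 i) phi (f1 (enorm x) * (x ord0 i / enorm x)).
  apply: near_eq_is_derive (is_derive_radial i x0 (ff1 _ (enorm_gt0 x0))).
  by near=> y; rewrite phif //; near: y; exact: near_neq0.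
by rewrite /partial (@derive_val _ _ _ _ _ _ _ h) mulrA mulrAC.
Unshelve. all: by end_near. Qed.

(** Off the origin the [i]-th partial derivative is [(f' / r) x_i]; a second one gives
    [(f' / r)' x_i^2 / r + f' / r], and the [x_i^2] sum to [r^2]. *)
Lemma laplacian_radial n (phi : 'rV[R]_n -> R) f f1 f2 :
  (forall y, y != 0 -> phi y = f (enorm y)) ->
  (forall r, 0 < r -> is_derive r 1 f (f1 r)) ->
  (forall r, 0 < r -> is_derive r 1 f1 (f2 r)) ->
  forall x, x != 0 ->
  laplacian phi x = f2 (enorm x) + (n%:R - 1) * f1 (enorm x) / enorm x.
Proof.
move=> phif ff1 f12 x x0; have ex0 := enorm_gt0 x0.
pose k' r := f2 r / r - f1 r / r ^+ 2.
have kk' r : 0 < r -> is_derive r 1 (fun s => f1 s / s) (k' r).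
  move=> r0; have h := is_deriveMf (f12 r r0)
    (is_deriveVf (f := id) (lt0r_neq0 r0) (is_derive_idf r)).
  by apply: (is_derive_eq h); rewrite /k' /=; field; rewrite gt_eqF.
have step i : partial i (partial i phi) x =
    k' (enorm x) / enorm x * x ord0 i ^+ 2 + f1 (enorm x) / enorm x.
  have h : is_derive x (delta_mx ord0 i) (partial i phi)
      (k' (enorm x) * (x ord0 i / enorm x) * x ord0 i + f1 (enorm x) / enorm x).
    apply: (near_eq_is_derive (f := fun y => f1 (enorm y) / enorm y * y ord0 i)).
      near=> y; rewrite (partial_radial i phif ff1) //.
      by near: y; exact: near_neq0.
    have hM := is_deriveM (is_derive_radial i x0 (kk' _ ex0)) (is_derive_coord x i i).
    apply: (is_derive_eq hM).
    by rewrite /GRing.scale /= eqxx mulr1 addrC mulrC.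
  by rewrite {1}/partial (@derive_val _ _ _ _ _ _ _ h); field; rewrite gt_eqF.
rewrite /laplacian (eq_bigr _ (fun i _ => step i)) big_split /= -mulr_sumr -sqr_enorm.
rewrite sumr_const card_ord -mulr_natl /k'.
by field; rewrite gt_eqF.
Unshelve. all: by end_near. Qed.

(* Jet of [f'' + (n - 1) f' / r]; only the entries 0, 1, 2 are meaningful. *)
Definition rlap n (f : nat -> R -> R) : nat -> R -> R := fun j r =>
  match j with
  | 0 => f 2%N r + (n%:R - 1) * f 1%N r / r
  | 1 => f 3%N r + (n%:R - 1) * (f 2%N r / r - f 1%N r / r ^+ 2)
  | _ => f 4%N r + (n%:R - 1) *
           (f 3%N r / r - 2 * f 2%N r / r ^+ 2 + 2 * f 1%N r / r ^+ 3)
  end.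

Lemma is_derive_div_powr f c k r : 0 < r -> is_derive r 1 f c ->
  is_derive r 1 (fun s => f s / s ^+ k) (c / r ^+ k - k%:R * f r / r ^+ k.+1).
Proof.
move=> r0 fc; have h := is_deriveMf fc (is_deriveVf (f := fun s => s ^+ k)
  (lt0r_neq0 (exprn_gt0 k r0)) (is_deriveXf k r)).
apply: (is_derive_eq h); case: k h => [|k] _ /=.
  by field; rewrite gt_eqF.
have P0 : r ^+ k != 0 by rewrite expf_neq0 // gt_eqF.
by rewrite !exprS; field; rewrite P0 gt_eqF.
Qed.

Lemma jet_rlap n (f : nat -> R -> R) : jet 4 f -> jet 2 (rlap n f).
Proof.
move=> jf [|[|//]] r _ r0.
  have h := is_deriveDf (jf 2%N r isT r0) (is_deriveZf (n%:R - 1)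
    (is_derive_div_powr 1 r0 (jf 1%N r isT r0))).
  have -> : rlap n f 0%N = (fun s => f 2%N s + (n%:R - 1) * (f 1%N s / s ^+ 1)).
    by apply/funext => s; rewrite /= expr1 mulrA.
  by apply: (is_derive_eq h); rewrite /= expr1 mul1r.
have h := is_deriveDf (jf 3%N r isT r0) (is_deriveZf (n%:R - 1)
    (is_deriveBf (is_derive_div_powr 1 r0 (jf 2%N r isT r0))
                 (is_derive_div_powr 2 r0 (jf 1%N r isT r0)))).
have -> : rlap n f 1%N =
    (fun s => f 3%N s + (n%:R - 1) * (f 2%N s / s ^+ 1 - f 1%N s / s ^+ 2)).
  by apply/funext => s; rewrite /= expr1.
by apply: (is_derive_eq h); rewrite /=; field; rewrite gt_eqF.
Qed.

Lemma bilaplacian_radial n (phi : 'rV[R]_n -> R) (f : nat -> R -> R) :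
  (forall y, y != 0 -> phi y = f 0%N (enorm y)) -> jet 4 f ->
  forall x, x != 0 -> bilaplacian phi x = rlap n (rlap n f) 0%N (enorm x).
Proof.
move=> phif jf x x0; have jg := jet_rlap n jf.
apply: (laplacian_radial (f := rlap n f 0%N) (f1 := rlap n f 1%N)
  (f2 := rlap n f 2%N)) => // [y y0|r|r]; [|exact: jg|exact: jg].
by apply: (laplacian_radial (f := f 0%N) (f1 := f 1%N) (f2 := f 2%N)) => // r;
  apply: jf.
Qed.

(** With [theta = r d/dr], [r^2 Delta = theta (theta + n - 2)]; moving the inner factor [r^(- 2)] to
    the left shifts [theta] by [- 2], which produces the four constants. *)
Lemma euler_rlap n (f : nat -> R -> R) r : 0 < r ->
  euler 0 (euler (- 2) (euler (n%:R - 2) (euler (n%:R - 4) f))) 0%N r =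
  r ^+ 4 * rlap n (rlap n f) 0%N r.
Proof. by move=> r0; rewrite /euler /rlap; field; rewrite gt_eqF. Qed.

(** The restriction of [phi] to one axis, with its derivatives. It is defined for all real [r], so
    regularity at the origin is ordinary regularity at [r = 0]. *)
Definition profile n (i : 'I_n) (phi : 'rV[R]_n -> R) : nat -> R -> R :=
  fun j r => iter j (partial i) phi (r *: delta_mx ord0 i).

Lemma CkW n k l (phi : 'rV[R]_n -> R) : (k <= l)%N -> Ck l phi -> Ck k phi.
Proof.
elim: l k phi => [|l IH] [|k] phi //= kl [cphi]; first by [].
move=> dphi; split=> // i; have [d C] := dphi i; split=> //; exact: IH C.
Qed.

Lemma Ck_iter_partial n (i : 'I_n) k j (phi : 'rV[R]_n -> R) :
  Ck (k + j) phi -> Ck k (iter j (partial i) phi).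
Proof.
elim: j phi => [|j IH] phi; first by rewrite addn0.
by rewrite addnS iterSr => -[_ /(_ i)[_ /IH]].
Qed.

Lemma profile_is_derive n (i : 'I_n) k (phi : 'rV[R]_n -> R) : Ck k phi ->
  forall j r, (j < k)%N -> is_derive r 1 (profile i phi j) (profile i phi j.+1 r).
Proof.
move=> Cphi j r jk.
have /(Ck_iter_partial i)[_ /(_ i)[phid _]] : Ck (1 + j) phi.
  by apply: CkW Cphi; rewrite add1n.
have /derivableP/is_derive_lineP h := phid (r *: delta_mx ord0 i).
have h1 : is_derive r 1 (fun s : R => s - r) 1.
  apply: (is_derive_eq (is_deriveBf (is_derive_idf r) (is_derive_cstf r r))).
  exact: subr0.
have h2 := is_derive_compf (f := fun h => iter j (partial i) phi
  (h *: delta_mx ord0 i + r *: delta_mx ord0 i)) h1.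
rewrite subrr in h2; have := h2 _ h; rewrite mulr1.
rewrite (_ : (fun y => _) = profile i phi j); first by [].
by apply/funext => y; rewrite /profile -scalerDl subrK.
Qed.

Lemma profile_continuous n (i : 'I_n) k (phi : 'rV[R]_n -> R) : Ck k phi ->
  forall j, (j <= k)%N -> continuous (profile i phi j).
Proof.
move=> Cphi j jk r.
have /(Ck_iter_partial i)[cphi _] : Ck (0 + j) phi by apply: CkW Cphi.
apply: (continuous_comp (f := fun s : R => s *: delta_mx ord0 i)
  (g := iter j (partial i) phi)); last exact: cphi.
exact: scalel_continuous.
Qed.

Lemma profileE n (i : 'I_n) (phi : 'rV[R]_n -> R) : radially_symmetric phi ->
  forall x, phi x = profile i phi 0%N (enorm x).
Proof.
move=> rphi x; apply: rphi; rewrite -[LHS]ger0_norm ?enorm_ge0 // -sqrtr_sqr.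
rewrite -[RHS]ger0_norm ?enorm_ge0 // -sqrtr_sqr; congr Num.sqrt.
rewrite [RHS]sqr_enorm (bigD1 i) //= big1 ?addr0 => [|j ji].
  by rewrite !mxE !eqxx mulr1.
by rewrite !mxE eqxx (negbTE ji) mulr0 expr0n.
Qed.

End Radial.

(** * Superlinear growth estimates *)

Section Boundedness.
Context {R : realType}.
Implicit Types (f : R -> R) (F : nat -> R -> R) (a b c h p r s t A B M : R).

(** Steps of length [2 h] with [h = 2^(- k)] have total length 4. The factor [h^4 = 16^(- k)] is
    beaten by the superlinear power, so [f] would reach [A B^k] for every [k] before [a + 4], where
    it is finite. *)
Lemma no_superlinear_doubling f c p a0 : 0 < c -> 1 < p ->
  (forall a h, a0 <= a -> 0 < h <= 1 -> c * h ^+ 4 * f a `^ p <= f (a + 2 * h)) ->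
  (forall a b, a0 <= a -> a <= b -> f a <= f b) ->
  (forall M, exists2 a, a0 <= a & M <= f a) -> False.
Proof.
move=> c0 p1 dbl mono unb.
have pm1 : 0 < p - 1 by rewrite subr_gt0.
have [d1 d10 Hd1] := powR_eventually_ge pm1 (ltr0n R 16 : 0 < 16).
(* [B] satisfies [B^p >= 16 B], which pays for the loss [16^(- k)], and [A] below satisfies
   [c A^p >= A B], which closes the induction. *)
pose B := Num.max d1 2.
have B2 : 2 <= B by rewrite /B le_max lexx orbT.
have B0 : 0 < B by apply: lt_le_trans B2.
have BB : B * 16 <= B `^ p.
  by rewrite powR_gt0B1 // ler_pM2l // Hd1 // /B le_max lexx.
have [d2 d20 Hd2] := powR_eventually_ge pm1 (divr_gt0 B0 c0).
pose A := d2.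
have A0 : 0 < A by [].
have AB : A * B <= c * A `^ p.
  have := Hd2 A (lexx _); rewrite ler_pdivrMr // => hA.
  rewrite (powR_gt0B1 p A0).
  by rewrite mulrCA ler_pM2l // mulrC.
have [a a0a fa] := unb A.
pose x k := a + 4 * (1 - 2^-1 ^+ k).
have half k : 0 < (2^-1 : R) ^+ k <= 1.
  by rewrite exprn_gt0 ?exprn_ile1 ?invr_ge0 ?invf_le1 ?ler1n ?invr_gt0.
have xa k : a0 <= x k.
  by rewrite /x; have /andP[_ ?] := half k; lra.
have key k : A * B ^+ k <= f (x k).
  elim: k => [|k IH].
    by rewrite /x !expr0 subrr mulr0 addr0 mulr1.
  have /andP[hk0 hk1] := half k.
  have := dbl (x k) (2^-1 ^+ k) (xa k) (half k).
  have -> : x k + 2 * 2^-1 ^+ k = x k.+1 by rewrite /x exprS; field.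
  apply: le_trans.
  have h1 : (A * B ^+ k) `^ p <= f (x k) `^ p.
    apply: ge0_ler_powR; rewrite ?nnegrE //; first by lra.
      by rewrite mulr_ge0 ?exprn_ge0 // ltW.
    by apply: le_trans IH; rewrite mulr_ge0 ?exprn_ge0 // ltW.
  have ck : 0 <= c * (2^-1 ^+ k) ^+ 4 by rewrite mulr_ge0 ?exprn_ge0 // ltW.
  apply: le_trans (ler_wpM2l ck h1).
  have -> : (A * B ^+ k) `^ p = A `^ p * (B `^ p) ^+ k.
    rewrite powRM ?exprn_ge0 ?(ltW A0) ?(ltW B0) //; congr (_ * _).
    by rewrite -!powR_mulrn ?powR_ge0 ?(ltW B0) // -!powRrM mulrC.
  have -> : c * (2^-1 ^+ k) ^+ 4 * (A `^ p * B `^ p ^+ k) =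
      c * A `^ p * (B `^ p / 16) ^+ k.
    rewrite -exprM mulnC exprM expr_div_n -exprVn (_ : (2^-1) ^+ 4 = 16^-1 :> R).
      by ring.
    by field.
  rewrite exprS mulrA; apply: ler_pM; rewrite ?exprn_ge0 ?mulr_ge0 ?(ltW A0) ?(ltW B0) //.
  by rewrite lerXn2r ?nnegrE ?divr_ge0 ?powR_ge0 ?(ltW B0) // ler_pdivlMr.
have bound k : A * B ^+ k <= f (a + 4).
  apply: le_trans (key k) _; apply: mono; first exact: xa.
  by rewrite /x; have /andP[? _] := half k; lra.
have kB k : k%:R <= B ^+ k.
  elim: k => [|k IH]; first by rewrite expr0.
  have : 1 <= B ^+ k by rewrite exprn_ege1 //; lra.
  by rewrite exprS -addn1 natrD => ?; nra.
have hx : 0 <= `|f (a + 4)| / A by rewrite divr_ge0 // ltW.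
have := archi_boundP hx; set k := Num.bound _ => hk.
have : `|f (a + 4)| < A * B ^+ k.
  by rewrite mulrC -ltr_pdivrMr // (lt_le_trans hk).
by rewrite ltNge (le_trans (bound k) (ler_norm _)).
Qed.

(** [(r^t F')' >= A r^t >= A a^t]; two integrations give quadratic growth, and dividing by [r^t]
    costs the factor [(a / b)^t]. *)
Lemma radial_growth t F a b A : 0 <= t -> 0 < a -> a <= b -> 0 <= A ->
  jet 2 F -> 0 <= F 1%N a ->
  (forall r, a <= r <= b -> A <= F 2%N r + t * F 1%N r / r) ->
  F 0%N a + (a / b) `^ t * A * (b - a) ^+ 2 / 2 <= F 0%N b.
Proof.
move=> t0 a0 ab A0 jF F1a HA.
have b0 : 0 < b by apply: lt_le_trans ab.
have jF1 : jet 1 (fun j => F j.+1) by move=> j r j1 r0; apply: jF.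
have h1 r : a <= r <= b -> a `^ t * A * (r - a) <= r `^ t * F 1%N r.
  move=> /andP[ar rb].
  have := le_of_derive_ge0 ar (f := fun y => y `^ t * F 1%N y - a `^ t * A * (y - a))
    (df := fun y => y `^ (t - 1) * euler t (fun j => F j.+1) 0%N y - a `^ t * A).
  rewrite subrr mulr0 subr0 => H.
  rewrite -subr_ge0; have F1a' := mulr_ge0 (powR_ge0 a t) F1a.
  apply: le_trans F1a' (H _ _).
  - move=> x /andP[ax _]; have x0 : 0 < x by apply: lt_le_trans ax.
    have hd := is_deriveBf (is_derive_powR_jet t jF1 x0)
      (is_deriveZf (a `^ t * A) (is_deriveBf (is_derive_idf x) (is_derive_cstf a x))).
    by apply: (is_derive_eq hd); rewrite subr0 mulr1.
  - move=> x /andP[ax xr]; have x0 : 0 < x by apply: lt_le_trans ax.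
    have hx : A <= F 2%N x + t * F 1%N x / x by apply: HA; rewrite ax (le_trans xr).
    have -> : x `^ (t - 1) * euler t (fun j => F j.+1) 0%N x =
        x `^ t * (F 2%N x + t * F 1%N x / x).
      by rewrite (powR_gt0B1 t x0) /euler; field; rewrite gt_eqF.
    rewrite subr_ge0; apply: ler_pM; rewrite ?powR_ge0 //.
    by apply: ge0_ler_powR; rewrite ?nnegrE ?(ltW a0) ?(ltW x0).
pose K := (a / b) `^ t * A.
have K0 : 0 <= K by rewrite /K mulr_ge0 ?powR_ge0.
have h2 r : a <= r <= b -> K * (r - a) <= F 1%N r.
  move=> arb; have := h1 r arb; have /andP[ar rb] := arb.
  have r0 : 0 < r by apply: lt_le_trans ar.
  rewrite -ler_pdivrMl ?powR_gt0 //; apply: le_trans.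
  rewrite /K !mulrA ler_wpM2r ?subr_ge0 // ler_wpM2r //.
  rewrite powRM ?invr_ge0 ?(ltW a0) ?(ltW b0) // mulrC ler_wpM2r ?powR_ge0 //.
  have -> : b^-1 `^ t = (b `^ t)^-1.
    apply: (mulIf (lt0r_neq0 (powR_gt0 t b0))).
    by rewrite mulVf ?gt_eqF ?powR_gt0 // -powRM ?invr_ge0 ?(ltW b0) // mulVf ?gt_eqF // powR1.
  rewrite lef_pV2 ?posrE ?powR_gt0 //.
  by apply: ge0_ler_powR; rewrite ?nnegrE ?(ltW r0) ?(ltW b0).
have := le_of_derive_ge0 ab (f := fun y => F 0%N y - K / 2 * ((y - a) * (y - a)))
    (df := fun y => F 1%N y - K * (y - a)).
rewrite subrr mulr0 mulr0 subr0 => H.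
have {}H : F 0%N a <= F 0%N b - K / 2 * ((b - a) * (b - a)).
  apply: H => x axb; have /andP[ax xb] := axb; have x0 : 0 < x by apply: lt_le_trans ax.
    have hd := is_deriveBf (is_derive_idf x) (is_derive_cstf a x).
    have hq := is_deriveBf (jF 0%N x isT x0) (is_deriveZf (K / 2) (is_deriveMf hd hd)).
    by apply: (is_derive_eq hq); field.
  by rewrite subr_ge0 h2.
by rewrite -/K; move: H; set z := b - a => H; rewrite expr2; lra.
Qed.

(** [F'''], [F'' / r] and [F' / r^2] are each [O(r^(- 3))], a singularity weaker than
    [r^(- (n - 1))] when [n >= 5]. *)
Lemma rlap_near0 n F : near0 0 3 F -> near0 3 0 (fun j => rlap n F j.+1).
Proof.
move=> nF [|//] _.
have [C1 H1] := nF 1%N isT; have [C2 H2] := nF 2%N isT.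
have [C3 H3] := nF 3%N isT.
exists (C3 + `|n%:R - 1| * (C2 + C1)) => r r01.
have r0 : 0 < r by case/andP: r01.
move: (H1 r r01) (H2 r r01) (H3 r r01).
rewrite oppr0 !powRr0 !mulr1 => h1 h2 h3.
rewrite powRN ler_pdivlMr ?powR_gt0 // powR_mulrn ?(ltW r0) //.
rewrite -(gtr0_norm (exprn_gt0 3 r0)) -normrM /rlap.
have -> : (F 3%N r + (n%:R - 1) * (F 2%N r / r - F 1%N r / r ^+ 2)) * r ^+ 3 =
    F 3%N r * r ^+ 3 + (n%:R - 1) * (F 2%N r * r ^+ 2 - F 1%N r * r ^+ 1).
  by field; rewrite gt_eqF.
apply: le_trans (ler_normD _ _) _; apply: lerD.
  by rewrite normrM (gtr0_norm (exprn_gt0 3 r0)).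
rewrite normrM ler_wpM2l //; apply: le_trans (ler_normB _ _) _; apply: lerD.
  by rewrite normrM (gtr0_norm (exprn_gt0 2 r0)).
by rewrite normrM (gtr0_norm (exprn_gt0 1 r0)).
Qed.

(** * Sign of the Laplacian and monotonicity of a single solution *)

Section Solution.
Variables (n : nat) (p : R) (F : nat -> R -> R).
Hypotheses (n5 : (5 <= n)%N) (p1 : 1 < p).
Hypotheses (jF : jet 4 F) (nF : near0 0 3 F).
Hypothesis F_gt0 : forall r, 0 < r -> 0 < F 0%N r.
Hypothesis eqF : forall r, 0 < r -> rlap n (rlap n F) 0%N r = F 0%N r `^ p.

Let t := n%:R - 1 : R.

Let t_gt3 : 3 < t.
Proof.
have : 5 <= n%:R :> R by rewrite (ler_nat R 5 n).
by rewrite /t; lra.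
Qed.

Let t0 : 0 <= t. Proof. by have := t_gt3; lra. Qed.

Let jG : jet 2 (rlap n F). Proof. exact: jet_rlap. Qed.

Let eqG r : 0 < r -> rlap n F 2%N r + t * rlap n F 1%N r / r = F 0%N r `^ p.
Proof. by move=> r0; rewrite -eqF. Qed.

(** For the solution [u], [r^(n - 1) (Delta u)'] has derivative [r^(n - 1) u^p >= 0] and tends to 0
    at the origin because [n - 1 > 3]. *)
Let G1_ge0 r : 0 < r -> 0 <= rlap n F 1%N r.
Proof.
move: r; apply: (@ge0_of_euler_ge0 R 3 t (fun j => rlap n F j.+1)) => //.
- by move=> j r j1 r0; apply: jG.
- exact: rlap_near0.
move=> r r0.
have -> : euler t (fun j => rlap n F j.+1) 0%N r =
    r * (rlap n F 2%N r + t * rlap n F 1%N r / r).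
  by rewrite /euler; field; rewrite gt_eqF.
by rewrite eqG // mulr_ge0 ?powR_ge0 // ltW.
Qed.

Let G_mono a b : 0 < a -> a <= b -> rlap n F 0%N a <= rlap n F 0%N b.
Proof.
move=> a0 ab; apply: (le_of_derive_ge0 ab (df := rlap n F 1%N)) => x /andP[ax _].
  by apply: jG => //; apply: lt_le_trans ax.
by apply: G1_ge0; apply: lt_le_trans ax.
Qed.

(** If [Delta u] were positive somewhere it would stay so, which makes [u] eventually nondecreasing
    and unbounded. Two applications of [radial_growth], to [Delta u] and then to [u], yield
    [u(a + 2 h) >= c h^4 u(a)^p], which [no_superlinear_doubling] excludes. *)
Lemma rlap_le0 r : 0 < r -> rlap n F 0%N r <= 0.
Proof.
move=> r0; rewrite leNgt; apply/negP => vr.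
set v1 := rlap n F 0%N r in vr.
(* Beyond 1 one has [y^t >= 1], so [(y^t F')' >= v1]. *)
pose s := Num.max r 1.
have s1 : 1 <= s by rewrite /s le_max lexx orbT.
have rs : r <= s by rewrite /s le_max lexx.
have s0 : 0 < s by apply: lt_le_trans s1.
have vge x : s <= x -> v1 <= rlap n F 0%N x.
  by move=> sx; apply: G_mono => //; apply: le_trans rs sx.
have jF1 : jet 1 (fun j => F j.+1) by move=> [] // x _ x0; apply: jF.
have lin x : s <= x -> s `^ t * F 1%N s - v1 * s <= x `^ t * F 1%N x - v1 * x.
  move=> sx.
  apply: (le_of_derive_ge0 sx (f := fun y => y `^ t * F 1%N y - v1 * y)
    (df := fun y => y `^ (t - 1) * euler t (fun j => F j.+1) 0%N y - v1 * 1)).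
    move=> y /andP[sy _]; have y0 : 0 < y by apply: lt_le_trans sy.
    exact (is_deriveBf (is_derive_powR_jet t jF1 y0) (is_deriveZf v1 (is_derive_idf y))).
  move=> y /andP[sy _]; have y0 : 0 < y by apply: lt_le_trans sy.
  have -> : y `^ (t - 1) * euler t (fun j => F j.+1) 0%N y = y `^ t * rlap n F 0%N y.
    by rewrite (powR_gt0B1 t y0) /euler /rlap -/t; field; rewrite gt_eqF.
  rewrite subr_ge0 mulrC; apply: ler_pM; rewrite ?(ltW vr) ?vge //.
  rewrite -(powRr0 y); apply: ler_powR => //; exact: le_trans sy.
set B := s `^ t * F 1%N s - v1 * s in lin.
pose r2 := Num.max s (`|B| / v1).
have sr2 : s <= r2 by rewrite /r2 le_max lexx.
have F1_ge0 x : r2 <= x -> 0 <= F 1%N x.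
  rewrite /r2 ge_max => /andP[sx Bx].
  have x0 : 0 < x by apply: lt_le_trans sx.
  rewrite -(pmulr_rge0 _ (powR_gt0 t x0)).
  have h := lin x sx; rewrite ler_pdivrMr // in Bx; rewrite [v1 * x]mulrC in h.
  have := ler_norm (- B); rewrite normrN => ?.
  lra.
have F_mono a b : r2 <= a -> a <= b -> F 0%N a <= F 0%N b.
  move=> ra ab; apply: (le_of_derive_ge0 ab (df := F 1%N)) => x /andP[ax _].
    by apply: jF => //; apply: lt_le_trans (le_trans sr2 (le_trans ra ax)).
  by apply: F1_ge0; apply: le_trans ax.
(* On intervals with [b <= 2 a] the factor [(a / b)^t] is at least [2^(- t)], uniformly in [a]. *)
pose kap := (2^-1 : R) `^ t.
have kap0 : 0 < kap by rewrite powR_gt0 // invr_gt0.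
have kapP a b : 0 < a -> a <= b -> b <= 2 * a -> kap <= (a / b) `^ t.
  move=> a0 ab ba; have b0 : 0 < b by apply: lt_le_trans ab.
  apply: ge0_ler_powR; rewrite ?nnegrE ?invr_ge0 ?divr_ge0 ?(ltW a0) ?(ltW b0) //.
  by rewrite ler_pdivlMr // ler_pdivrMl.
have growF a b : r2 <= a -> a <= b -> b <= 2 * a ->
    kap * rlap n F 0%N a * (b - a) ^+ 2 / 2 <= F 0%N b.
  move=> ra ab ba; have sa := le_trans sr2 ra.
  have a0 : 0 < a by apply: lt_le_trans sa.
  have va : 0 <= rlap n F 0%N a by rewrite (le_trans (ltW vr)) ?vge.
  have hv x : a <= x <= b -> rlap n F 0%N a <= F 2%N x + t * F 1%N x / x.
    by move=> /andP[ax _]; apply: (G_mono a0 ax).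
  have H := radial_growth t0 a0 ab va (jetW (isT : (2 <= 4)%N) jF) (F1_ge0 a ra) hv.
  apply: le_trans H; rewrite ler_wpDl ?(ltW (F_gt0 a0)) //.
  by rewrite ler_wpM2r ?invr_ge0 // ler_wpM2r ?sqr_ge0 // ler_wpM2r // kapP.
(* The constant is the product of two gains [kap / 2], one on [[a, a + h]] for the Laplacian and one
   on [[a + h, a + 2 h]] for the function. *)
apply: (@no_superlinear_doubling (F 0%N) (kap ^+ 2 / 4) p r2) => //.
- by rewrite divr_gt0 // exprn_gt0.
- move=> a h ra /andP[h0 h1]; have sa := le_trans sr2 ra.
  have a0 : 0 < a by apply: lt_le_trans sa.
  have a1 : 1 <= a by apply: le_trans sa.
  have ah : a <= a + h by lra.
  have Fp : 0 <= F 0%N a `^ p by apply: powR_ge0.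
  have := growF (a + h) (a + 2 * h); rewrite (_ : a + 2 * h - (a + h) = h); last by ring.
  have e1 : a + h <= a + 2 * h by lra.
  have e2 : a + 2 * h <= 2 * (a + h) by lra.
  move=> /(_ (le_trans ra ah) e1 e2) H2; apply: le_trans H2.
  have := radial_growth t0 a0 ah Fp jG (G1_ge0 a0).
  rewrite (_ : a + h - a = h); last by ring.
  have hF x : a <= x <= a + h ->
      F 0%N a `^ p <= rlap n F 2%N x + t * rlap n F 1%N x / x.
    move=> /andP[ax _]; have x0 : 0 < x by apply: lt_le_trans ax.
    rewrite eqG //; apply: ge0_ler_powR; last exact: F_mono.
    - exact: le_trans ler01 (ltW p1).
    - by rewrite nnegrE ltW ?F_gt0.
    - by rewrite nnegrE ltW ?F_gt0.
  move=> /(_ hF) H1.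
  have va : 0 <= rlap n F 0%N a by rewrite (le_trans (ltW vr)) ?vge.
  have kh : kap <= (a / (a + h)) `^ t by apply: kapP => //; lra.
  have H3 : kap * F 0%N a `^ p * h ^+ 2 / 2 <= rlap n F 0%N (a + h).
    apply: le_trans H1; rewrite ler_wpDl //.
    by rewrite ler_wpM2r ?invr_ge0 // ler_wpM2r ?sqr_ge0 // ler_wpM2r.
  have -> : kap ^+ 2 / 4 * h ^+ 4 * F 0%N a `^ p =
    kap * (kap * F 0%N a `^ p * h ^+ 2 / 2) * h ^+ 2 / 2 by field.
  rewrite ler_wpM2r ?invr_ge0 // ler_wpM2r ?sqr_ge0 // ler_wpM2l //.
  exact: ltW.
- move=> M.
  pose a := Num.max r2 (`|M| / (kap * v1 / 2)).
  have ra : r2 <= a by rewrite /a le_max lexx.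
  have Ma : `|M| / (kap * v1 / 2) <= a by rewrite /a le_max lexx orbT.
  have kv : 0 < kap * v1 / 2 by rewrite divr_gt0 // mulr_gt0.
  have a1 : 1 <= a by apply: le_trans (le_trans s1 sr2) ra.
  exists (2 * a); first by lra.
  have a2a : a <= 2 * a by lra.
  apply: le_trans (growF a (2 * a) ra a2a (lexx _)).
  rewrite ler_pdivrMr // in Ma; apply: le_trans (ler_norm M) (le_trans Ma _).
  have va : v1 <= rlap n F 0%N a by apply: vge; apply: le_trans ra.
  have -> : kap * rlap n F 0%N a * (2 * a - a) ^+ 2 / 2 =
    a * (kap * (a * rlap n F 0%N a) / 2) by field.
  rewrite ler_wpM2l ?(le_trans _ a1) // ler_wpM2r ?invr_ge0 // ler_wpM2l ?(ltW kap0) //.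
  exact: le_trans va (ler_peMl (le_trans (ltW vr) va) a1).
Qed.

(** [r^(n - 1) u'] has derivative [r^(n - 1) Delta u <= 0] and tends to 0 at the origin, so
    [u' <= 0]. *)
Lemma profile_nonincreasing a b : 0 < a -> a <= b -> F 0%N b <= F 0%N a.
Proof.
have jN : jet 1 (fun j x => - F j.+1 x).
  move=> j x j1 x0; have jx : (j.+1 < 4)%N by case: j j1.
  have h := is_deriveZf (-1) (jF jx x0).
  rewrite (_ : (fun y => - F j.+1 y) = fun y => -1 * F j.+1 y).
    by apply: (is_derive_eq h); rewrite mulN1r.
  by apply/funext => y; rewrite mulN1r.
have F1_le0 x : 0 < x -> F 1%N x <= 0.
  move=> x0; rewrite -oppr_ge0; move: x x0.
  apply: (@ge0_of_euler_ge0 R 1 t (fun j x => - F j.+1 x)) => //.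
  - move=> [|//] _; have [C HC] := nF (isT : (1 <= 3)%N).
    exists C => x x01; have x0 : 0 < x by case/andP: x01.
    have := HC x x01; rewrite oppr0 powRr0 mulr1 normrN expr0 mulr1 expr1.
    by rewrite powRN powRr1 ?(ltW x0) // ler_pdivlMr.
  - by have := t_gt3; lra.
  - move=> x x0; have := rlap_le0 x0; rewrite -(pmulr_rle0 _ x0) => h.
    have -> : euler t (fun j x => - F j.+1 x) 0%N x = - (x * rlap n F 0%N x).
      by rewrite /euler /rlap -/t; field; rewrite gt_eqF.
    by rewrite oppr_ge0.
move=> a0 ab; rewrite -lerN2.
apply: (le_of_derive_ge0 ab (f := fun y => - F 0%N y) (df := fun y => -1 * F 1%N y)).
  move=> x /andP[ax _]; have x0 : 0 < x by apply: lt_le_trans ax.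
  rewrite (_ : (fun y => - F 0%N y) = fun y => -1 * F 0%N y).
    exact: is_deriveZf (jF (isT : (0 < 4)%N) x0).
  by apply/funext => y; rewrite mulN1r.
by move=> x /andP[ax _]; rewrite mulN1r oppr_ge0 F1_le0 // (lt_le_trans a0).
Qed.

End Solution.

End Boundedness.

(** * Comparison with the singular solution and between regular solutions *)

Section Comparison.
Context {R : realType}.
Implicit Types (D E F G : nat -> R -> R) (a b c k l m p r t C K M : R) (j n N : nat).

Definition powjet a : nat -> R -> R :=
  fun j r => (\prod_(i < j) (a - i%:R)) * r `^ (a - j%:R).

Definition lin_jet a D b E : nat -> R -> R := fun j r => a * D j r + b * E j r.

(** This is [r^4 Delta^2] on radial functions, by [euler_rlap]. *)
Definition euler4 n D : nat -> R -> R :=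
  euler 0 (euler (- 2) (euler (n%:R - 2) (euler (n%:R - 4) D))).

Lemma powjet0E a r : powjet a 0%N r = r `^ a.
Proof. by rewrite /powjet big_ord0 mul1r subr0. Qed.

Lemma powjetS a j r : 0 < r -> r * powjet a j.+1 r = (a - j%:R) * powjet a j r.
Proof.
move=> r0; rewrite /powjet big_ord_recr /=.
rewrite (_ : r `^ (a - j%:R) = r * r `^ (a - j.+1%:R)); last first.
  rewrite -{2}(powRr1 (ltW r0)) -powR_gt0D //; congr powR.
  by rewrite -addn1 natrD; ring.
by ring.
Qed.

Lemma jet_powjet N a : jet N (powjet a).
Proof.
move=> j r _ r0.
have h := is_deriveZf (\prod_(i < j) (a - i%:R)) (is_derive_powRf (a - j%:R) r0).
apply: (is_derive_eq h); rewrite /powjet big_ord_recr /= mulrA; congr (_ * _ `^ _).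
by rewrite -addn1 natrD; ring.
Qed.

Lemma near0_powjet N k : near0 k N (powjet (- k)).
Proof.
move=> j _; exists `|\prod_(i < j) (- k - i%:R)| => r /andP[r0 _].
rewrite /powjet normrM -mulrA ler_wpM2l // ger0_norm ?powR_ge0 //.
by rewrite -powR_mulrn ?(ltW r0) // -powR_gt0D // subrK.
Qed.

Lemma eq_euler_scale c D E t r : (forall j, D j r = c * E j r) ->
  forall j, euler t D j r = c * euler t E j r.
Proof. by move=> DE j; rewrite /euler !DE; ring. Qed.

Lemma euler_powjet a t r : 0 < r ->
  forall j, euler t (powjet a) j r = (t + a) * powjet a j r.
Proof. by move=> r0 j; rewrite /euler powjetS //; ring. Qed.

(** A power is an eigenfunction of every Euler operator: a factor [theta + t] multiplies [r^(- m)]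
    by [t - m], and the product of the four values is [Q4 m]. *)
Lemma euler4_powjet n m r : 0 < r ->
  euler4 n (powjet (- m)) 0%N r = Q4 n m * r `^ (- m).
Proof.
move=> r0; have h t j := @euler_powjet (- m) t r r0 j.
have h2 := eq_euler_scale (n%:R - 2) (h (n%:R - 4)).
have h3 c t D := @eq_euler_scale c D (powjet (- m)) t r.
rewrite /euler4.
have {}h2 j : euler (n%:R - 2) (euler (n%:R - 4) (powjet (- m))) j r =
    (n%:R - 4 - m) * (n%:R - 2 - m) * powjet (- m) j r.
  by rewrite h2 h mulrA.
have {}h3 j : euler (- 2) (euler (n%:R - 2) (euler (n%:R - 4) (powjet (- m)))) j r =
    (n%:R - 4 - m) * (n%:R - 2 - m) * (- 2 - m) * powjet (- m) j r.
  by rewrite (h3 _ _ _ h2) h mulrA.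
by rewrite (eq_euler_scale 0 h3) h powjet0E /Q4; ring.
Qed.

Lemma jet_lin N a D b E : jet N D -> jet N E -> jet N (lin_jet a D b E).
Proof.
move=> jD jE j r jN r0.
exact: is_deriveDf (is_deriveZf a (jD j r jN r0)) (is_deriveZf b (jE j r jN r0)).
Qed.

Lemma near0_lin k N a D b E : near0 k N D -> near0 k N E ->
  near0 k N (lin_jet a D b E).
Proof.
move=> nD nE j jN; have [C HC] := nD j jN; have [C' HC'] := nE j jN.
exists (`|a| * C + `|b| * C') => r r01; have /andP[r0 _] := r01.
apply: le_trans (_ : `|a| * (`|D j r| * r ^+ j) + `|b| * (`|E j r| * r ^+ j) <= _).
  rewrite /lin_jet !mulrA -mulrDl ler_wpM2r ?exprn_ge0 ?(ltW r0) //.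
  by rewrite -!normrM ler_normD.
by rewrite mulrDl -!mulrA; apply: lerD; rewrite ler_wpM2l ?HC ?HC'.
Qed.

Lemma near0_weaken k l N D : k <= l -> near0 k N D -> near0 l N D.
Proof.
move=> kl nD j jN; have [C HC] := nD j jN; exists `|C| => r r01.
apply: le_trans (HC r r01) _.
apply: le_trans (ler_wpM2r (powR_ge0 _ _) (ler_norm C)) _.
by rewrite ler_wpM2l // ger_powR // lerN2.
Qed.

Lemma euler_lin t a D b E :
  euler t (lin_jet a D b E) = lin_jet a (euler t D) b (euler t E).
Proof. by apply/funext => j; apply/funext => r; rewrite /euler /lin_jet; ring. Qed.

Lemma euler4_lin n a D b E :
  euler4 n (lin_jet a D b E) = lin_jet a (euler4 n D) b (euler4 n E).
Proof. by rewrite /euler4 !euler_lin. Qed.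

(** The form in which a solution enters the comparison: [near0 0 3] records regularity at the
    origin, and continuity at 0 ties the profile to the central value. *)
Definition radial_solution n p F :=
  [/\ jet 4 F, near0 0 3 F, forall r, 0 <= r -> 0 < F 0%N r,
      continuous (F 0%N) &
      forall r, 0 < r -> rlap n (rlap n F) 0%N r = F 0%N r `^ p].

Section Supercritical.
Variables (n : nat) (p : R).
Hypotheses (n13 : (13 <= n)%N) (p1 : 1 < p).
Let m := 4 / (p - 1).
Hypotheses (m0 : 0 < m) (mN : m < (n%:R - 4) / 2).
Hypothesis Qp : p * Q4 n m <= Q4 n ((n%:R - 4) / 2).

Let q := Q4 n m.
Let K := q `^ (1 / (p - 1)).

Let q0 : 0 < q. Proof. exact: Q4_gt0. Qed.
Let K0 : 0 < K. Proof. exact: powR_gt0. Qed.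
Let pm1 : 0 < p - 1. Proof. by rewrite subr_gt0. Qed.
Let p0 : 0 < p. Proof. exact: lt_trans p1. Qed.

(** This makes the potential [p Phi^(p - 1)] of the linearization equal to [p q / r^4], so that
    after multiplication by [r^4] the operator has constant coefficients in [theta]. *)
Lemma singular_powR r : 0 < r -> r ^+ 4 * (K * r `^ (- m)) `^ (p - 1) = q.
Proof.
move=> r0; rewrite powRM ?(ltW K0) ?powR_ge0 // -!powRrM.
rewrite (_ : 1 / (p - 1) * (p - 1) = 1); last by field; rewrite gt_eqF.
rewrite (_ : - m * (p - 1) = - 4); last by rewrite /m; field; rewrite gt_eqF.
rewrite powRr1 ?(ltW q0) // powRN powR_mulrn ?(ltW r0) //.
by field; rewrite gt_eqF.
Qed.

Lemma radial_solution_decr F : radial_solution n p F ->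
  forall a b, 0 < a -> a <= b -> F 0%N b <= F 0%N a.
Proof.
move=> [jF nF F0 _ eF] a b; apply: (@profile_nonincreasing R n p F) => //.
- exact: leq_trans n13.
- by move=> r r0; apply: F0; apply: ltW.
Qed.

Lemma euler4_solution F : radial_solution n p F ->
  forall r, 0 < r -> euler4 n F 0%N r = r ^+ 4 * F 0%N r `^ p.
Proof. by move=> [_ _ _ _ eF] r r0; rewrite /euler4 euler_rlap // eF. Qed.

Lemma exponents : exists t1 t2 t3 t4 : R, [/\ m < t1, m < t2, m < t3, t4 < - 2 &
  forall D r, euler t4 (euler t3 (euler t2 (euler t1 D))) 0%N r =
    euler4 n D 0%N r - p * q * D 0%N r].
Proof. by apply: Q4_shift_roots => //; rewrite -/q ltr_pMl. Qed.

Lemma not_eventually_below s f c r0 : 0 < s -> (forall r, r0 <= r -> - c <= f r) ->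
  ~ eventually_below s f.
Proof.
move=> s0 fc [c' [r1 [c'0 r10 Hf]]].
have cc : 0 < (`|c| + 1) / c' by rewrite divr_gt0 // ltr_wpDl.
have [d d0 Hd] := powR_eventually_ge s0 cc.
pose r := Num.max r0 (Num.max r1 d).
have := fc r; rewrite /r le_max lexx => /(_ isT) h1.
have := Hf r; rewrite /r !le_max lexx orbT => /(_ isT) h2.
have := Hd r; rewrite /r !le_max lexx !orbT => /(_ isT).
rewrite ler_pdivrMr // => h3; have := ler_norm c.
by rewrite mulrC in h2; lra.
Qed.

Lemma lt_singular F : radial_solution n p F ->
  forall r, 0 < r -> F 0%N r < K * r `^ (- m).
Proof.
move=> sF; have [jF nF F0 cF eF] := sF.
have [t1 [t2 [t3 [t4 [mt1 mt2 mt3 t42 E]]]]] := exponents.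
pose D := lin_jet K (powjet (- m)) (- 1) F.
have D0E r : D 0%N r = K * r `^ (- m) - F 0%N r.
  by rewrite /D /lin_jet powjet0E mulN1r.
have Phi0 r : 0 < r -> 0 < K * r `^ (- m) by move=> r0; rewrite mulr_gt0 ?powR_gt0.
have jD : jet 4 D by apply: jet_lin => //; apply: jet_powjet.
have nD : near0 m 3 D.
  apply: near0_lin; first exact: near0_powjet.
  exact: near0_weaken (ltW m0) nF.
(* Since [r^4 Phi^p = q Phi], this is the tangent inequality at [Phi] multiplied by [r^4]. *)
have ED r : 0 < r -> euler t4 (euler t3 (euler t2 (euler t1 D))) 0%N r <= 0.
  move=> r0; rewrite E D0E /D euler4_lin /lin_jet euler4_powjet // euler4_solution //.
  rewrite -/q; have Fr := F0 r (ltW r0).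
  have := powR_tangent p1 (Phi0 r r0) (ltW Fr).
  have xE := powR_gt0B1 p (Phi0 r r0).
  rewrite xE -(ler_pM2l (exprn_gt0 4 r0)).
  have S := singular_powR r0.
  set X := (K * r `^ (- m)) in S *; set Y := X `^ (p - 1) in S *.
  rewrite (_ : r ^+ 4 * (p * Y * (F 0%N r - X)) = p * (r ^+ 4 * Y) * (F 0%N r - X)); last by ring.
  rewrite (_ : r ^+ 4 * (F 0%N r `^ p - X * Y) = r ^+ 4 * F 0%N r `^ p - X * (r ^+ 4 * Y)); last by ring.
  rewrite S (_ : K * (q * r `^ (- m)) = X * q); last by rewrite /X; ring.
  by rewrite mulN1r; set Z := r ^+ 4 * _; lra.
have nbD : ~ eventually_below (- t4) (D 0%N).
  apply: (@not_eventually_below _ _ (F 0%N 1) 1); first by lra.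
  move=> r r1; rewrite D0E; have r0 : 0 < r by apply: lt_le_trans r1.
  have := Phi0 r r0; have := radial_solution_decr sF ltr01 r1; lra.
have t40 : t4 < 0 by lra.
have [D0 Dmono] := euler4_comparison (ltW m0) mt1 mt2 mt3 t40 jD nD ED nbD.
move=> r0 r00; rewrite lt_neqAle; apply/andP; split; last first.
  by have := D0 r0 r00; rewrite D0E subr_ge0.
apply/negP => /eqP eq0.
(* A contact at [r0] is a zero of the nonnegative nondecreasing function [r^t1 D], so contact
   persists down to the origin. *)
have FE r : 0 < r -> r <= r0 -> F 0%N r = K * r `^ (- m).
  move=> rg rr0; have := Dmono r r0 rg rr0.
  rewrite [X in _ <= _ * X]D0E eq0 subrr mulr0 => h.
  have h2 : D 0%N r <= 0 by rewrite -(pmulr_rle0 _ (powR_gt0 t1 rg)).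
  have h3 := D0 r rg; have h4 : D 0%N r = 0 by apply: le_anti; rewrite h2 h3.
  by move: h4; rewrite D0E => /eqP; rewrite subr_eq0 => /eqP.
have [C HC] := nF 0%N isT.
(* The radius is taken so small that [Phi >= 2 (|C| + 1)], whereas [F] is at most [C] on
   [(0, 1]]. *)
have KC : 0 < K / (2 * (`|C| + 1)) by rewrite divr_gt0 // mulr_gt0 // ltr_wpDl.
have [d d0 Hd] := powR_eventually_le m0 KC.
pose r := Num.min r0 (Num.min 1 d).
have rg : 0 < r by rewrite /r !lt_min r00 ltr01 d0.
have rr0 : r <= r0 by rewrite /r ge_min lexx.
have r1 : r <= 1 by rewrite /r !ge_min lexx orbT.
have rd : r <= d by rewrite /r !ge_min lexx !orbT.
have := HC r; rewrite rg r1 oppr0 powRr0 mulr1 expr0 mulr1 FE // => /(_ isT).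
rewrite gtr0_norm ?Phi0 // powRN ler_pdivrMr ?powR_gt0 // => h1.
have := Hd r; rewrite rg rd => /(_ isT).
rewrite ler_pdivlMr ?mulr_gt0 ?ltr_wpDl // => h2.
have rm := powR_gt0 m rg.
have h3 : C * r `^ m <= `|C| * r `^ m by rewrite ler_wpM2r ?ler_norm // ltW.
have h4 : 0 <= `|C| * r `^ m by rewrite mulr_ge0 // ltW.
rewrite mulrCA mulrDr mulr1 [_ * `|C|]mulrC in h2.
by lra.
Qed.

(* Adding the constant [M] keeps the differential inequality and makes the
   difference nonnegative. *)
Lemma max_gap_false F G M r0 : radial_solution n p F -> radial_solution n p G ->
  G 0%N 0 < F 0%N 0 -> 0 <= M -> 0 < r0 ->
  (forall r, 0 < r -> G 0%N r - F 0%N r <= M) -> G 0%N r0 - F 0%N r0 = M -> False.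
Proof.
move=> sF sG FG0 M0 r00 leM eqM.
have [jF nF F0 cF eF] := sF; have [jG nG G0 cG eG] := sG.
have [t1 [t2 [t3 [t4 [mt1 mt2 mt3 t42 E]]]]] := exponents.
(* The power with exponent 0 encodes the constant, which [euler4] annihilates because [Q4 0 = 0]. *)
pose D := lin_jet M (powjet (- 0)) 1 (lin_jet 1 F (- 1) G).
have D0E r : D 0%N r = M + F 0%N r - G 0%N r.
  by rewrite /D /lin_jet powjet0E oppr0 powRr0; ring.
have D_ge0 r : 0 < r -> 0 <= D 0%N r.
  by move=> rg; rewrite D0E; have := leM r rg; lra.
have jD : jet 4 D by apply: jet_lin; [exact: jet_powjet | exact: jet_lin].
have nD : near0 0 3 D by apply: near0_lin; [exact: near0_powjet | exact: near0_lin].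
have ED r : 0 < r -> euler t4 (euler t3 (euler t2 (euler t1 D))) 0%N r <= 0.
  move=> rg; rewrite E /D !euler4_lin -/D /lin_jet euler4_powjet // !euler4_solution //.
  rewrite (_ : Q4 n 0 = 0); last by rewrite /Q4 !mul0r.
  have Fr := F0 r (ltW rg); have Gr := G0 r (ltW rg); have r4 := exprn_gt0 4 rg.
  rewrite mul0r mulr0 add0r mul1r mulN1r mul1r -mulrBr subr_le0.
  have pq0 : 0 < p * q by rewrite mulr_gt0.
  (* Where [F <= G] the left side is nonpositive and the right side nonnegative. Where [G < F], the
     tangent at [F] and [F < Phi] bound [r^4 (F^p - G^p)] by [p q (F - G)], and [M >= 0] gives
     [F - G <= D]. *)
  have [FleG|GltF] := leP (F 0%N r) (G 0%N r).
    apply: (@le_trans _ _ 0); last by rewrite mulr_ge0 ?(ltW pq0) ?D_ge0.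
    rewrite pmulr_rle0 // subr_le0.
    by apply: ge0_ler_powR => //; rewrite ?nnegrE ?(ltW p0) ?(ltW Fr) ?(ltW Gr).
  have T := powR_tangent p1 Fr (ltW Gr); rewrite -(ler_pM2l r4) in T.
  apply: (@le_trans _ _ (p * (r ^+ 4 * F 0%N r `^ (p - 1)) * (F 0%N r - G 0%N r))).
    rewrite -subr_ge0 in T; rewrite -subr_ge0.
    by apply: le_trans T (eq_ler _); ring.
  apply: (@le_trans _ _ (p * q * (F 0%N r - G 0%N r))).
    rewrite ler_wpM2r ?subr_ge0 ?(ltW GltF) // ler_wpM2l ?(ltW p0) //.
    rewrite -(singular_powR rg) ler_wpM2l ?(ltW r4) //.
    apply: ge0_ler_powR; rewrite ?nnegrE ?(ltW pm1) ?(ltW Fr) //.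
      by rewrite mulr_ge0 ?powR_ge0.
    exact: ltW (lt_singular sF rg).
  by rewrite ler_wpM2l ?(ltW pq0) // D0E; lra.
have nbD : ~ eventually_below (- t4) (D 0%N).
  apply: (@not_eventually_below _ _ 0 1); first by lra.
  by move=> r r1; rewrite oppr0 D_ge0 // (lt_le_trans ltr01).
have t40 : t4 < 0 by lra.
have [_ Dmono] := euler4_comparison (lexx 0) (lt_trans m0 mt1) (lt_trans m0 mt2)
  (lt_trans m0 mt3) t40 jD nD ED nbD.
(* The gap [M] is attained at [r0], so [D] vanishes on all of [(0, r0]]; yet its limit at 0 is
   [M + F(0) - G(0) > 0]. *)
have D_eq0 r : 0 < r -> r <= r0 -> D 0%N r = 0.
  move=> rg rr0; have := Dmono r r0 rg rr0.
  have -> : D 0%N r0 = 0 by rewrite D0E -eqM; ring.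
  rewrite mulr0 pmulr_rle0 ?powR_gt0 // => h.
  by apply: le_anti; rewrite h D_ge0.
have cD : {for 0, continuous (fun r => M + F 0%N r - G 0%N r)}.
  by apply: cvgB; [apply: cvgD; [exact: cvg_cst | exact: cF] | exact: cG].
have Dpos : 0 < M + F 0%N 0 - G 0%N 0 by lra.
have [e /= e0 He] : \forall r \near (0 : R), 0 < M + F 0%N r - G 0%N r.
  exact: (cvgr_gt _ cD).
pose r := Num.min r0 (e / 2).
have rg : 0 < r by rewrite /r lt_min r00 divr_gt0.
have rr0 : r <= r0 by rewrite /r ge_min lexx.
have re : r < e.
  by apply: le_lt_trans (_ : e / 2 < e); [rewrite /r ge_min lexx orbT | lra].
have := He r; rewrite /ball /= sub0r normrN gtr0_norm // => /(_ re).
by have := D_eq0 r rg rr0; rewrite D0E => ->; rewrite ltxx.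
Qed.

(** If [G] reached [F], the gap [G - F] would attain a nonnegative maximum at a positive radius,
    which [max_gap_false] forbids. *)
Lemma radial_solution_lt F G : radial_solution n p F -> radial_solution n p G ->
  G 0%N 0 < F 0%N 0 -> forall r, 0 <= r -> G 0%N r < F 0%N r.
Proof.
move=> sF sG FG0 r1 r10; rewrite ltNge; apply/negP => le1.
have [jF nF F0 cF eF] := sF; have [jG nG G0 cG eG] := sG.
pose w r := G 0%N r - F 0%N r.
have [[r2 [r20 w2]]|nw] := pselect (exists r, 0 <= r /\ 0 < w r); last first.
  have w_le0 r : 0 <= r -> w r <= 0.
    by move=> rg; rewrite leNgt; apply/negP => wr; apply: nw; exists r.
  have w1 : w r1 = 0 by apply: le_anti; rewrite w_le0 //= subr_ge0.
  apply: (@max_gap_false F G 0 r1) => //.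
    rewrite lt_neqAle r10 andbT; apply/eqP => r1E; move: w1; rewrite /w -r1E; lra.
  by move=> r rg; apply: w_le0; apply: ltW.
(* Beyond [d], [G - F < Phi <= w r2], so the maximum over [[0, b]] is a global one. *)
have [d d0 Hd] := powR_eventually_ge m0 (divr_gt0 K0 w2).
pose b := Num.max r2 d.
have b0 : 0 <= b by rewrite /b le_max r20.
have [c /[!in_itv]/= /andP[c0 cb] cmax] : exists2 c, c \in `[0, b] &
    forall t, t \in `[0, b] -> w t <= w c.
  apply: EVT_max => //; apply: continuous_subspaceT => x.
  by apply: cvgB; [exact: cG | exact: cF].
have wc : w r2 <= w c.
  by apply: cmax; rewrite in_itv /= r20 /b le_max lexx.
apply: (@max_gap_false F G (w c) c) => //.
- by apply: le_trans wc; apply: ltW.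
(* The maximum is not attained at the centre, where the gap is negative. *)
- rewrite lt_neqAle c0 andbT; apply/eqP => cE.
  by move: wc w2; rewrite -cE {2}/w; lra.
move=> r rg; have [rb|br] := leP r b.
  by apply: cmax; rewrite in_itv /= (ltW rg).
apply: le_trans wc.
have := Hd r; rewrite (le_trans _ (ltW br)) ?le_max ?lexx ?orbT // => /(_ isT).
rewrite ler_pdivrMr // => Kr.
have Gr := lt_singular sG rg; have Fr := F0 r (ltW rg).
have : K * r `^ (- m) <= w r2 by rewrite powRN ler_pdivrMr ?powR_gt0 // mulrC.
by lra.
Qed.

End Supercritical.

End Comparison.

(** * Passage from [R^n] to profiles, and the theorem *)

Lemma radial_solution_profile (R : realType) n (p : R) (phi : 'rV[R]_n -> R) (i : 'I_n) :
  positive_radial_solution p phi -> radial_solution n p (profile i phi).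
Proof.
move=> [Cphi phi0 rphi ephi].
have jF : jet 4 (profile i phi).
  by move=> j r j4 _; apply: profile_is_derive Cphi j r j4.
have cF := profile_continuous (i := i) Cphi.
split=> //.
- move=> j j3.
  (* Each derivative of order at most 3 is continuous, hence bounded on [[0, 1]], and there
     [r^j <= 1]. *)
  have [c _ cmax] : exists2 c, c \in `[0, 1] &
      forall t, t \in `[(0 : R), 1] -> `|profile i phi j t| <= `|profile i phi j c|.
    apply: (EVT_max (f := fun t => `|profile i phi j t|)); first exact: ler01.
    apply: continuous_subspaceT => x.
    by apply: cvg_norm; apply: cF; apply: leqW.
  exists `|profile i phi j c| => r /andP[r0 r1].
  rewrite oppr0 powRr0; apply: ler_pM => //.
  - by rewrite exprn_ge0 // ltW.
  - by apply: cmax; rewrite in_itv /= (ltW r0).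
  - by rewrite exprn_ile1 // ltW.
- by move=> r _; apply: phi0.
- exact: cF.
move=> r r0; pose x : 'rV[R]_n := r *: delta_mx ord0 i.
have ex : enorm x = r.
  rewrite -[LHS]ger0_norm ?enorm_ge0 // -sqrtr_sqr sqr_enorm (bigD1 i) //= big1.
    by rewrite !mxE !eqxx mulr1 addr0 sqrtr_sqr gtr0_norm.
  by move=> j ji; rewrite !mxE eqxx (negbTE ji) mulr0 expr0n.
have x0 : x != 0.
  by apply/eqP => xE; move: r0; rewrite -ex xE enorm0 ltxx.
rewrite -{1}ex -(bilaplacian_radial (phi := phi) (fun y _ => profileE i rphi y) jF x0).
exact: ephi.
Qed.

Theorem theorem9 (R : realType) (n : nat) (pc p : R) (alpha beta : R)
    (phi_alpha phi_beta : 'rV[R]_n -> R)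
    (hn : (13 <= n)%N)
    (hpc : (n%:R + 4) / (n%:R - 4) < pc)
    (hpcE : pc * Q4 n (4 / (pc - 1)) = Q4 n ((n%:R - 4) / 2))
    (hp : pc <= p)
    (halpha : 0 < alpha) (hbeta : 0 < beta)
    (hphi_alpha : positive_radial_solution p phi_alpha)
    (hphi_beta : positive_radial_solution p phi_beta)
    (hphi_alpha0 : phi_alpha 0 = alpha)
    (hphi_beta0 : phi_beta 0 = beta) :
  (forall x : 'rV[R]_n, x != 0 -> phi_alpha x <> singular_solution p x) /\
  (alpha <> beta -> forall x : 'rV[R]_n, phi_alpha x <> phi_beta x).
Proof.
(* Any coordinate axis serves, by radial symmetry. *)
have i : 'I_n by exact: Ordinal (leq_trans (isT : (0 < 13)%N) hn).
have [p1 m0 mN] := exponent_bounds hn (lt_le_trans hpc hp).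
have Qp := Q4_supercritical hn hpc hpcE hp.
have sa := radial_solution_profile i hphi_alpha.
have sb := radial_solution_profile i hphi_beta.
have Ea := profileE i (let: And4 _ _ h _ := hphi_alpha in h).
have Eb := profileE i (let: And4 _ _ h _ := hphi_beta in h).
split=> [x x0 | ab x].
  rewrite Ea /singular_solution /=; apply/eqP; rewrite lt_eqF //.
  have h := lt_singular hn p1 m0 mN Qp sa (enorm_gt0 x0).
  exact h.
have F0 : profile i phi_alpha 0%N 0 = alpha by rewrite -hphi_alpha0 Ea enorm0.
have G0 : profile i phi_beta 0%N 0 = beta by rewrite -hphi_beta0 Eb enorm0.
rewrite Ea Eb; apply/eqP.
have [lt_ab|lt_ba|//] := ltgtP alpha beta.
  by rewrite lt_eqF // (radial_solution_lt hn p1 m0 mN Qp sb sa) ?enorm_ge0 // F0 G0.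
by rewrite gt_eqF // (radial_solution_lt hn p1 m0 mN Qp sa sb) ?enorm_ge0 // F0 G0.
Qed.
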